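(* Let $\rho : G \to O(V)$ be an orthogonal representation of a finite group $G$ on a real finite-dimensional Euclidean vector space $V$, and assume that $\rho$ has property $(\mathcal{B}_k)$. Let $d=d(\rho)$ and let $c : \mathbb{R} \to V/G = \sigma(V) \subseteq \mathbb{R}^n$ be a curve of class $C^{k+d}$. Then any differentiable lift $\bar{c}$ of $c$ is actually of class $C^1$.
   Context: Let $\mathbb{R}[V]^G$ be the (finitely generated) algebra of $G$-invariant real polynomials on $V$, let $\sigma_1,\ldots,\sigma_n$ be homogeneous generators of positive degree, and $\sigma=(\sigma_1,\ldots,\sigma_n):V\to\mathbb{R}^n$ the orbit map; $V/G$ is identified with $\sigma(V)\subseteq\mathbb{R}^n$ via the homeomorphism induced by $\sigma$. A curve in $V/G$ is of class $C^k$ if it is $C^k$ as a curve in $\mathbb{R}^n$ (independent of the choice of generators). A lift of a curve $c$ in $\sigma(V)$ is a curve $\bar c$ in $V$ with $\sigma\circ\bar c=c$; a local lift near $t_0$ is a lift of the restriction of $c$ to an open neighborhood of $t_0$. A differentiable lift has locally bounded derivative if $\|\bar c'\|$ is bounded on compact subsets of its domain. $\rho$ has property $(\mathcal{B}_k)$ if there exists a neighborhood $U$ of $0$ in $V/G=\sigma(V)$ such that each $C^k$-curve in $U$ admits (near each parameter value) a local differentiable lift to $V$ with locally bounded derivative. Here $k\in\{0,1,2,\ldots,\infty,\omega\}$ ($C^\omega$ meaning real analytic), with $\infty+m=\infty$, $\omega+m=\omega$ for integers $m$. $d(\rho)$ is the maximum of the degrees of the elements of a minimal system of homogeneous generators of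 positive degree of $\mathbb{R}[V]^G$ (independent of the choice of minimal system). *)

(* Defs.v *)
From HB Require Import structures.
From mathcomp Require Import all_boot all_order all_algebra all_fingroup.
From mathcomp Require Import mxrepresentation.
(* The notations of mpoly clash with those of mathcomp-analysis. *)
From mathcomp Require Import -(notations) mpoly.
From mathcomp Require Import all_classical all_reals all_analysis.

Set Implicit Arguments.
Unset Strict Implicit.
Unset Printing Implicit Defensive.

Import GRing.Theory Num.Theory.
Import numFieldNormedType.Exports.

Local Open Scope classical_set_scope.
Local Open Scope ring_scope.

(* The indices k in {0, 1, 2, ..., oo, omega}. *)
Inductive smoothness := Fin of nat | Infty | Omega.

Definition add_smoothness (k : smoothness) (d : nat) : smoothness :=
  if k is Fin j then Fin (j + d) else k.

Definition class_Cn (R : realType) (n k : nat) (c : R -> 'cV[R]_n) : Prop :=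
  (forall i t, (i < k)%N -> derivable (derive1n i c) t 1)
  /\ continuous (derive1n k c).

Definition real_analytic (R : realType) (n : nat) (c : R -> 'cV[R]_n) : Prop :=
  forall t0 : R, exists a : nat -> 'cV[R]_n,
    \forall t \near t0, series (fun j : nat => (t - t0) ^+ j *: a j) @ \oo --> c t.

Definition of_class (R : realType) (n : nat) (k : smoothness)
    (c : R -> 'cV[R]_n) : Prop :=
  match k with
  | Fin j => class_Cn j c
  | Infty => forall j, class_Cn j c
  | Omega => real_analytic c
  end.

Definition enorm (R : realType) (m : nat) (v : 'cV[R]_m) : R :=
  Num.sqrt ((v^T *m v) 0 0).

(* V is R^m with the standard inner product (coordinates in an orthonormal
   basis), and g in G acts on column vectors by v |-> rho g *m v. *)
Definition orthogonal_repr (R : realType) (gT : finGroupType) (G : {group gT})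
    (m : nat) (rho : mx_representation R G m) : Prop :=
  forall g, g \in G -> (rho g)^T *m rho g = 1%:M.

Definition poly_eval (R : realType) (m : nat) (p : mpoly m R) (v : 'cV[R]_m)
    : R :=
  meval (fun i => v i 0) p.

Definition invariant_poly (R : realType) (gT : finGroupType) (G : {group gT})
    (m : nat) (rho : mx_representation R G m) (p : mpoly m R) : Prop :=
  forall g v, g \in G -> poly_eval p (rho g *m v) = poly_eval p v.

(* The total degree; msize p is one more than the degree of a nonzero p. *)
Definition poly_degree (R : realType) (m : nat) (p : mpoly m R) : nat :=
  (mmeasure mdeg p).-1.

Definition homogeneous_generators (R : realType) (gT : finGroupType)
    (G : {group gT}) (m : nat) (rho : mx_representation R G m)
    (s : seq (mpoly m R)) : Prop :=
  (forall p, p \in s ->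
     [/\ invariant_poly rho p, p \is ishomog mdeg
       & (0 < poly_degree p)%N])
  /\ (forall p, invariant_poly rho p ->
        exists q : mpoly (size s) R, p = comp_mpoly (in_tuple s) q).

Definition minimal_generators (R : realType) (gT : finGroupType)
    (G : {group gT}) (m : nat) (rho : mx_representation R G m)
    (s : seq (mpoly m R)) : Prop :=
  homogeneous_generators rho s
  /\ (forall s', subseq s' s -> homogeneous_generators rho s' -> s' = s).

(* d(rho); a minimal system of homogeneous generators always exists, and the
   maximal degree does not depend on which one is picked. *)
Definition max_degree (R : realType) (gT : finGroupType) (G : {group gT})
    (m : nat) (rho : mx_representation R G m) : nat :=
  xget 0%N [set d | exists2 s, minimal_generators rho s &
                      d = \max_(p <- s) poly_degree p].

Definition orbit_map (R : realType) (m n : nat) (sigma : n.-tuple (mpoly m R))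
    (v : 'cV[R]_m) : 'cV[R]_n :=
  \col_i poly_eval (tnth sigma i) v.

Definition orbit_space (R : realType) (m n : nat)
    (sigma : n.-tuple (mpoly m R)) : set 'cV[R]_n :=
  range (orbit_map sigma).

Definition differentiable_lift_on (R : realType) (m n : nat)
    (sigma : n.-tuple (mpoly m R)) (c : R -> 'cV[R]_n) (I : set R)
    (cbar : R -> 'cV[R]_m) : Prop :=
  forall t, I t -> orbit_map sigma (cbar t) = c t /\ derivable cbar t 1.

Definition locally_bounded_derivative_on (R : realType) (m : nat) (I : set R)
    (cbar : R -> 'cV[R]_m) : Prop :=
  forall K : set R, compact K -> K `<=` I ->
    exists M : R, forall t, K t -> enorm (derive1 cbar t) <= M.

(* Only the values of cbar on I matter. A neighborhood of 0 in sigma(V) is the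
   trace W `&` orbit_space sigma of a neighborhood W of 0 in R^n. *)
Definition property_B (R : realType) (m n : nat)
    (sigma : n.-tuple (mpoly m R)) (k : smoothness) : Prop :=
  exists2 W : set 'cV[R]_n, nbhs (0 : 'cV[R]_n) W &
    forall c : R -> 'cV[R]_n, of_class k c ->
      (forall t, (W `&` orbit_space sigma) (c t)) ->
      forall t0, exists I : set R, exists cbar : R -> 'cV[R]_m,
        [/\ open I, I t0, differentiable_lift_on sigma c I cbar
          & locally_bounded_derivative_on I cbar].

(* Main.v *)
Require Import Defs.
From HB Require Import structures.
From mathcomp Require Import all_boot all_order all_algebra all_fingroup.
From mathcomp Require Import mxrepresentation.
From mathcomp Require Import -(notations) mpoly.
From mathcomp Require Import all_classical all_reals all_analysis.
From mathcomp Require Import ring lra.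

Set Implicit Arguments.
Unset Strict Implicit.
Unset Printing Implicit Defensive.

Import Order.TTheory GRing.Theory Num.Theory.
Import numFieldNormedType.Exports.

Local Open Scope classical_set_scope.
Local Open Scope ring_scope.

(** The derivative of cbar at t0 is compared with that of another lift, built from
    the difference quotient w t = (cbar t - cbar t0) / (t - t0). Let H be the
    stabiliser of v0 = cbar t0, and let d be the largest degree of a minimal
    generator.

    A polynomial invariant under H is as smooth along cbar as c is, near t0: it is
    a root of a polynomial with G-invariant coefficients, and this root becomes
    simple once a multiple of the squared distance to v0 is added and the
    multiplicity due to H is removed by differentiation
    (smooth_near_stab_invariant). Expand a generator f along the ray from a small
    multiple v of v0 in the direction w. Its Taylor coefficients of degree e are
    H-invariant polynomials of cbar divided by (t - t0)^e, where e <= d. Division by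
    (t - t0)^e costs e orders of smoothness, so the orbit curve of v + nu * w is of
    class k (smooth_near_quotient).

    For small v and nu this orbit curve lies in the neighbourhood provided by
    property_B; composed with an analytic map of the line into a small interval
    around t0, it becomes a curve on the whole line. It therefore has a local
    differentiable lift e with locally bounded derivative, and e can be taken in the
    H-orbit of v + nu * w. Then v0 + (t - t0) (e - v) / nu is a lift of c near t0. Its
    derivative is continuous at t0, because the bounded derivative of e is
    multiplied by t - t0 (exists_C1_local_lift).

    Two differentiable lifts have, at each parameter, derivatives that differ by an
    element of the finite group G (derive_in_orbit). So near t0 the coordinates of
    the derivative of cbar avoid all but finitely many values, and a derivative
    with this property is continuous at t0 (derivative_continuous_at).

    The classes C^j, C^oo and C^omega are treated uniformly. What is needed of each
    is stability under polynomial operations, composition, simple roots of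
    polynomials and division by t - t0. For C^j this follows by induction on j;
    for C^omega it is obtained from approximation by polynomials at a geometric
    rate, measured in a weighted norm of their coefficients. *)

(** * Germs of finite smoothness *)

Section FiniteSmoothness.
Context {R : realType}.
Implicit Types (f g q y : R -> R) (t : R).

(** The derivatives are carried along as existential data, so that closure under
    the algebraic operations is an induction on j in which no iterated
    derivative is ever computed. *)
Fixpoint Cgerm (j : nat) (f : R -> R) (t0 : R) : Prop :=
  if j is j'.+1 then
    exists2 g : R -> R, (\forall t \near t0, is_derive t (1 : R) f (g t)) & Cgerm j' g t0
  else \forall t \near t0, {for t, continuous f}.

Lemma is_derive_continuous f t l : is_derive t (1:R) f l -> {for t, continuous f}.
Proof. by case=> /derivable1_diffP/differentiable_continuous. Qed.

Lemma near_eq_continuous f g t :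
  (\near t, f t = g t) -> {for t, continuous f} -> {for t, continuous g}.
Proof.
move=> fg; rewrite /prop_for /continuous_at -(nbhs_singleton fg) => cf.
apply: cvg_trans cf; apply: near_eq_cvg.
by apply: filterS fg => x ->.
Qed.

Lemma Cgerm_eq j f g t0 : (\near t0, f t0 = g t0) -> Cgerm j f t0 -> Cgerm j g t0.
Proof.
case: j => [|j] fg /=.
  move=> cf; near=> t; apply: (@near_eq_continuous f); last by near: t.
  by near: t; exact: (near_join fg).
case=> h fh hj; exists h => //; near=> t.
apply: (@near_eq_is_derive _ _ _ f); last by near: t.
by near: t; exact: (near_join fg).
Unshelve. all: by end_near. Qed.

Lemma CgermW j f t0 : Cgerm j.+1 f t0 -> Cgerm j f t0.
Proof.
elim: j f => [|j IH] f [h fh hj] /=.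
  by apply: filterS fh => t; exact: is_derive_continuous.
by exists h => //; exact: IH.
Unshelve. all: by end_near. Qed.

Lemma Cgerm_le j i f t0 : (i <= j)%N -> Cgerm j f t0 -> Cgerm i f t0.
Proof.
by move=> ij; rewrite -(subnK ij); elim: (j - i)%N => // l IH /CgermW.
Qed.

Lemma Cgerm_cont j f t0 : Cgerm j f t0 -> {for t0, continuous f}.
Proof. by move=> /(Cgerm_le (leq0n j)) /= /nbhs_singleton. Qed.

Lemma Cgerm_cst j (a : R) t0 : Cgerm j (fun=> a) t0.
Proof.
elim: j a => [|j IH] a /=; first by near=> t; exact: cst_continuous.
by exists (fun=> 0) => //; near=> t; exact: is_derive_cst.
Unshelve. all: by end_near. Qed.

Lemma Cgerm_id j t0 : Cgerm j (fun t => t) t0.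
Proof.
case: j => [|j] /=; first by near=> t; exact: cvg_id.
by exists (fun=> 1); [near=> t; exact: is_derive_id | exact: Cgerm_cst].
Unshelve. all: by end_near. Qed.

Lemma CgermD j f g t0 :
  Cgerm j f t0 -> Cgerm j g t0 -> Cgerm j (fun t => f t + g t) t0.
Proof.
elim: j f g => [|j IH] f g /=.
  by move=> cf cg; near=> t; apply: continuousD; near: t.
move=> [f' df cf] [g' dg cg]; exists (fun t => f' t + g' t); last exact: IH.
by near=> t; apply: is_deriveD; near: t.
Unshelve. all: by end_near. Qed.

Lemma CgermM j f g t0 :
  Cgerm j f t0 -> Cgerm j g t0 -> Cgerm j (fun t => f t * g t) t0.
Proof.
elim: j f g => [|j IH] f g.
  by move=> /= cf cg; near=> t; apply: continuousM; near: t.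
move=> cf cg; case: (cf) => f' df cf'; case: (cg) => g' dg cg'.
exists (fun t => f t * g' t + g t * f' t).
  by near=> t; apply: is_deriveM; near: t.
by apply: CgermD; apply: IH => //; exact: CgermW.
Unshelve. all: by end_near. Qed.

Lemma CgermN j f t0 : Cgerm j f t0 -> Cgerm j (fun t => - f t) t0.
Proof.
move=> cf; apply: (@Cgerm_eq _ (fun t => (-1) * f t)).
  by near=> t; rewrite mulN1r.
by apply: CgermM => //; exact: Cgerm_cst.
Unshelve. all: by end_near. Qed.

Lemma near_neq0 f t0 : {for t0, continuous f} -> f t0 != 0 ->
  \forall t \near t0, f t != 0.
Proof. by move=> cf f0; exact: (cvgr_neq0 _ cf f0). Qed.

Lemma CgermV j f t0 : f t0 != 0 -> Cgerm j f t0 -> Cgerm j (fun t => (f t)^-1) t0.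
Proof.
move=> f0; elim: j => [|j IH] cf.
  have nf := near_neq0 (Cgerm_cont cf) f0.
  near=> t; apply: continuousV; [by near: t | near: t; exact: cf].
have nf := near_neq0 (Cgerm_cont cf) f0.
case: (cf) => f' df cf'; exists (fun t => - ((f t)^-1 * (f t)^-1) * f' t).
  near=> t; have dft : is_derive t (1 : R) f (f' t) by near: t.
  apply: is_derive_eq; first by apply: is_deriveV; near: t.
  by rewrite expr2 invfM.
have ci := IH (CgermW cf).
by apply: CgermM => //; apply: CgermN; exact: CgermM.
Unshelve. all: by end_near. Qed.

Lemma Cgerm_comp j f g t0 :
  Cgerm j f (g t0) -> Cgerm j g t0 -> Cgerm j (f \o g) t0.
Proof.
elim: j f => [|j IH] f cf cg.
  have /nbhs_singleton cg0 := cg.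
  near=> t; apply: continuous_comp; first by near: t.
  near: t; exact: (cg0 _ cf).
have cg0 := Cgerm_cont cg.
case: cf => f' df cf'; case: (cg) => g' dg cg'.
exists (fun t => (f' \o g) t * g' t).
  near=> t; apply: is_derive1_comp; last by near: t.
  near: t; exact: (cg0 _ df).
by apply: CgermM => //; apply: IH => //; exact: CgermW.
Unshelve. all: by end_near. Qed.

Lemma Cgerm_sum j (n : nat) (F : nat -> R -> R) t0 :
  (forall i, (i < n)%N -> Cgerm j (F i) t0) ->
  Cgerm j (fun t => \sum_(i < n) F i t) t0.
Proof.
elim: n => [|n IH] H.
  apply: (@Cgerm_eq _ (fun=> 0)); last exact: Cgerm_cst.
  by near=> t; rewrite big_ord0.
apply: (@Cgerm_eq _ (fun t => \sum_(i < n) F i t + F n t)).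
  by near=> t; rewrite big_ord_recr.
by apply: CgermD; [apply: IH => i ?; apply: H; exact: ltnW | exact: H].
Unshelve. all: by end_near. Qed.

Lemma CgermX j f n t0 : Cgerm j f t0 -> Cgerm j (fun t => f t ^+ n) t0.
Proof.
move=> cf; elim: n => [|n IH].
  by apply: (@Cgerm_eq _ (fun=> 1)); [near=> t; rewrite expr0 | exact: Cgerm_cst].
by apply: (@Cgerm_eq _ (fun t => f t * f t ^+ n));
  [near=> t; rewrite exprS | exact: CgermM].
Unshelve. all: by end_near. Qed.

Lemma is_derive_sum_pt n (F F' : nat -> R -> R) t :
  (forall i, (i < n)%N -> is_derive t (1 : R) (F i) (F' i t)) ->
  is_derive t (1 : R) (fun t => \sum_(i < n) F i t) (\sum_(i < n) F' i t).
Proof.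
elim: n => [|n IH] H.
  rewrite (_ : (fun _ => _) = cst 0); last by apply/funext => x; rewrite big_ord0.
  by rewrite big_ord0; exact: is_derive_cst.
rewrite (_ : (fun _ => _) = (fun t => \sum_(i < n) F i t) + F n); last first.
  by apply/funext => x; rewrite big_ord_recr.
rewrite big_ord_recr; apply: is_deriveD; last exact: H.
by apply: IH => i ?; apply: H; exact: ltnW.
Qed.

Lemma is_deriveX_pt n f t (l : R) : is_derive t (1 : R) f l ->
  is_derive t (1 : R) (fun t => f t ^+ n) (n%:R * f t ^+ n.-1 * l).
Proof.
move=> df; rewrite (_ : (fun _ => _) = f ^+ n); first exact: is_deriveX.
by rewrite exprfctE.
Qed.

Lemma is_deriveB_pt f g t (l k : R) :
  is_derive t (1 : R) f l -> is_derive t (1 : R) g k ->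
  is_derive t (1 : R) (fun x => f x - g x) (l - k).
Proof. by move=> df dg; exact: is_deriveB. Qed.

Lemma is_deriveD_pt f g t (l k : R) :
  is_derive t (1 : R) f l -> is_derive t (1 : R) g k ->
  is_derive t (1 : R) (fun x => f x + g x) (l + k).
Proof. by move=> df dg; exact: is_deriveD. Qed.

Lemma is_deriveM_pt f g t (l k : R) :
  is_derive t (1 : R) f l -> is_derive t (1 : R) g k ->
  is_derive t (1 : R) (fun x => f x * g x) (f t * k + g t * l).
Proof. by move=> df dg; exact: is_deriveM. Qed.

Lemma is_deriveMl_pt (a : R) f t (l : R) : is_derive t (1 : R) f l ->
  is_derive t (1 : R) (fun x => a * f x) (a * l).
Proof. by move=> df; exact: (is_deriveZ a df). Qed.

Lemma is_derive_subc (a : R) t : is_derive t (1 : R) (fun x => x - a) 1.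
Proof.
have := is_deriveB_pt (is_derive_id t (1 : R)) (is_derive_cst a t (1 : R)).
by rewrite subr0.
Qed.

Lemma is_derive_subcV (a : R) t : t - a != 0 ->
  is_derive t (1 : R) (fun x => (x - a)^-1) (- (t - a) ^- 2).
Proof.
move=> ta; have := @is_deriveV R (fun x => x - a) t 1 1 ta (is_derive_subc a t).
by rewrite /GRing.scale /= mulr1.
Qed.

(** Differentiability of y being known, differentiating the equation gives
    y' = - Q / P, where P is the derivative of the polynomial in its unknown and
    Q comes from differentiating its coefficients. The right-hand side is as
    smooth as y, so one order of smoothness is gained at a time. *)
Lemma Cgerm_root j n (b : nat -> R -> R) y t0 :
  (forall i, (i < n)%N -> Cgerm j (b i) t0) ->
  (\forall t \near t0, derivable y t 1) ->
  (\forall t \near t0, \sum_(i < n) b i t * y t ^+ i = 0) ->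
  \sum_(i < n) b i t0 * (i%:R * y t0 ^+ i.-1) != 0 ->
  Cgerm j y t0.
Proof.
move=> + dy root0 simple; elim: j => [|j IH] cb.
  near=> t; apply/differentiable_continuous/derivable1_diffP.
  by near: t.
have cyj : Cgerm j y t0 by apply: IH => i ?; exact/CgermW/cb.
have cyj0 := Cgerm_cont cyj.
have /boolp.choice[b' Hb'] : forall i, exists bi' : R -> R, (i < n)%N ->
    (\forall t \near t0, is_derive t (1 : R) (b i) (bi' t)) /\ Cgerm j bi' t0.
  move=> i; case: (ltnP i n) => [/cb[bi ? ?]|_]; first by exists bi.
  by exists (fun=> 0).
pose P t := \sum_(i < n) b i t * (i%:R * y t ^+ i.-1).
pose Q t := \sum_(i < n) b' i t * y t ^+ i.
have cP : Cgerm j P t0.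
  apply: (@Cgerm_sum _ _ (fun i t => b i t * (i%:R * y t ^+ i.-1))) => i ni.
  apply: CgermM; first exact/CgermW/cb.
  by apply: CgermM; [exact: Cgerm_cst | exact: CgermX].
have cQ : Cgerm j Q t0.
  apply: (@Cgerm_sum _ _ (fun i t => b' i t * y t ^+ i)) => i ni.
  by apply: CgermM; [exact: (Hb' _ ni).2 | exact: CgermX].
have nP := near_neq0 (Cgerm_cont cP) simple.
have db : \forall t \near t0, forall i : 'I_n, is_derive t (1 : R) (b i) (b' i t).
  refine (@filter_forall _ _
    (fun (i : 'I_n) t => is_derive t (1 : R) (b i) (b' i t)) (nbhs t0) _ _) => i.
  exact: (Hb' _ (ltn_ord i)).1.
exists (fun t => - (Q t * (P t)^-1)); last first.
  by apply/CgermN/CgermM => //; exact: CgermV.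
have root1 := near_join root0.
near=> t.
have dyt : is_derive t (1 : R) y ('D_1 y t) by apply: derivableP; near: t.
suff <- : 'D_1 y t = - (Q t * (P t)^-1) by [].
have Pt0 : P t != 0 by near: t.
have dbt : forall i : 'I_n, is_derive t (1 : R) (b i) (b' i t) by near: t.
have : is_derive t (1 : R) (fun t => \sum_(i < n) b i t * y t ^+ i)
    (\sum_(i < n) (b i t * (i%:R * y t ^+ i.-1 * 'D_1 y t) + y t ^+ i * b' i t)).
  apply: (@is_derive_sum_pt n (fun i t => b i t * y t ^+ i)
    (fun i t => b i t * (i%:R * y t ^+ i.-1 * 'D_1 y t) + y t ^+ i * b' i t)).
  move=> i ni; have di := dbt (Ordinal ni).
  by apply: is_deriveM; [exact: di | exact: is_deriveX_pt].
have : is_derive t (1 : R) (fun t => \sum_(i < n) b i t * y t ^+ i) 0.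
  apply: near_eq_is_derive (is_derive_cst (0 : R) t (1 : R)).
  have : \near t, \sum_(i < n) b i t * y t ^+ i = 0 by near: t; exact: root1.
  by apply: filterS => x /= ->.
move=> [_ E0] [_]; rewrite E0 => /esym; rewrite big_split /=.
rewrite (_ : \sum_(i < n) _ = P t * 'D_1 y t); last first.
  by rewrite mulr_suml; apply: eq_bigr => i _; rewrite !mulrA.
rewrite (_ : \sum_(i < n) _ = Q t); last by apply: eq_bigr => i _; rewrite mulrC.
move=> /eqP; rewrite addr_eq0 => /eqP PQ.
by rewrite -mulNr -PQ mulrAC divff// mul1r.
Unshelve. all: by end_near. Qed.

End FiniteSmoothness.

(** * Hadamard division *)

Section HadamardDivision.
Context {R : realType}.
Implicit Types (f g q b B : R -> R) (t : R).

(** The exceptional point is allowed because quotients by t - t0 are known to be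
    differentiable only away from t0. *)
Lemma mean_value_bound f g t0 t (K : R) :
  {for t0, continuous f} ->
  (forall x, x != t0 -> `|x - t0| <= `|t - t0| ->
     is_derive x (1 : R) f (g x) /\ `|g x| <= K) ->
  `|f t - f t0| <= K * `|t - t0|.
Proof.
move=> cf H.
have cont x : `|x - t0| <= `|t - t0| -> {for x, continuous f}.
  by have [-> //|xt0 /(H _ xt0)[/is_derive_continuous]] := eqVneq x t0.
have [lt|lt|->] := ltgtP t t0; last by rewrite !subrr normr0 mulr0.
- have [x||x] := @MVT R f g t t0 lt.
  + rewrite in_itv /= => /andP[tx xt]; apply: (H _ _ _).1; first by rewrite lt_eqF.
    by rewrite !ltr0_norm ?subr_lt0// lerN2 lerB// ltW.
  + apply: continuous_in_subspaceT => x; rewrite inE /= in_itv /= => /andP[tx xt].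
    by apply: cont; rewrite !ler0_norm ?subr_le0 ?(ltW lt)// lerN2 lerB.
  + rewrite in_itv /= => /andP[tx xt] E.
    rewrite distrC E normrM (distrC t); apply: ler_wpM2r => //.
    apply: (H _ _ _).2; first by rewrite lt_eqF.
    by rewrite !ltr0_norm ?subr_lt0// lerN2 lerB// ltW.
- have [x||x] := @MVT R f g t0 t lt.
  + rewrite in_itv /= => /andP[tx xt]; apply: (H _ _ _).1; first by rewrite gt_eqF.
    by rewrite !gtr0_norm ?subr_gt0// lerB// ltW.
  + apply: continuous_in_subspaceT => x; rewrite inE /= in_itv /= => /andP[tx xt].
    by apply: cont; rewrite !ger0_norm ?subr_ge0 ?(ltW lt)// lerB.
  + rewrite in_itv /= => /andP[tx xt] E.
    rewrite E normrM; apply: ler_wpM2r => //.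
    apply: (H _ _ _).2; first by rewrite gt_eqF.
    by rewrite !gtr0_norm ?subr_gt0// lerB// ltW.
Qed.

Lemma near_ball t0 (P : R -> Prop) : (\forall t \near t0, P t) ->
  exists2 e : R, 0 < e & forall t, `|t - t0| < e -> P t.
Proof.
move=> /nbhs_ballP[e /= e0 H]; exists e => // t te; apply: H.
by rewrite /ball /= distrC.
Qed.

Lemma ball_near t0 (P : R -> Prop) (e : R) : 0 < e ->
  (forall t, `|t - t0| < e -> P t) -> \forall t \near t0, P t.
Proof.
move=> e0 H; apply/nbhs_ballP; exists e => //= t.
by rewrite /ball /= distrC; exact: H.
Qed.

Lemma near_neq t t0 : t != t0 -> \forall x \near t, x != t0.
Proof.
move=> tt0; apply: (@ball_near _ _ `|t - t0|) => [|x].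
  by rewrite normr_gt0 subr_eq0.
by apply: contraPN => /eqP ->; rewrite distrC ltxx.
Qed.

Lemma continuous_epsP f t0 : {for t0, continuous f} <->
  forall e : R, 0 < e -> \forall t \near t0, `|f t - f t0| <= e.
Proof.
split=> [/cvgrPdist_le H e e0|H]; last apply/cvgrPdist_le => e e0.
  by apply: filterS (H e e0) => t; rewrite distrC.
by apply: filterS (H e e0) => t; rewrite distrC.
Qed.

(** By the mean value bound for f - g t0 * id, the difference quotient at t0 is as
    close to g t0 as g is on a small interval. *)
Lemma is_derive_extend f g t0 :
  {for t0, continuous f} -> {for t0, continuous g} ->
  (\forall t \near t0, t != t0 -> is_derive t (1 : R) f (g t)) ->
  is_derive t0 (1 : R) f (g t0).
Proof.
move=> cf /continuous_epsP cg H.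
apply/is_derive1_caratheodory.
exists (fun z => if z == t0 then g t0 else (f z - f t0) / (z - t0)).
split; last by rewrite eqxx.
  move=> z; have [->|zt] := eqVneq z t0; first by rewrite !subrr mulr0.
  by rewrite divfK// subr_eq0.
apply/continuous_epsP => e e0; rewrite eqxx.
have /near_ball[d d0 Hd] : \forall t \near t0,
    (t != t0 -> is_derive t (1 : R) f (g t)) /\ `|g t - g t0| <= e.
  by apply: filterI => //; exact: cg.
apply: (ball_near d0) => t td.
have [_|tt0] := eqVneq t t0; first by rewrite subrr normr0 ltW.
have nz : t - t0 != 0 by rewrite subr_eq0.
rewrite (_ : _ - _ = ((f t - g t0 * t) - (f t0 - g t0 * t0)) / (t - t0)); last first.
  by field.
rewrite normrM normfV ler_pdivrMr ?normr_gt0//.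
apply: (@mean_value_bound (fun x => f x - g t0 * x) (fun x => g x - g t0)).
  apply: continuousB => //; apply: continuousM; last exact: cvg_id.
  exact: cst_continuous.
move=> x xt0 xt; have [dx gx] := Hd x (le_lt_trans xt td); split => //.
have dfx := dx xt0.
have dix : is_derive x (1 : R) (fun x : R => x) 1 by exact: is_derive_id.
by have := is_deriveB_pt dfx (is_deriveMl_pt (g t0) dix); rewrite mulr1.
Qed.


(** Differentiating (t - t0) q' + (m + 1) q = B gives the same equation for q',
    with m + 1 and B' in place of m and B: this is what makes the induction on
    the order work. At t0 itself, (t - t0)^(m+2) q' has derivative
    (t - t0)^(m+1) B', whence q' tends to B' t0 / (m + 2). *)
Lemma Cgerm_hadamard_ode j m q q1 B t0 :
  Cgerm j B t0 -> {for t0, continuous q} ->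
  (\forall t \near t0, t != t0 -> is_derive t (1 : R) q (q1 t) /\
     (t - t0) * q1 t + m.+1%:R * q t = B t) ->
  Cgerm j q t0.
Proof.
elim: j m q q1 B => [|j IH] m q q1 B cB cq ode.
  apply: filterS ode => t; have [->//|tt0] := eqVneq t t0.
  by move=> /(_ isT)[/is_derive_continuous].
have cB0 := Cgerm_cont cB.
case: (cB) => B1 dB cB1; have /continuous_epsP cB10 := Cgerm_cont cB1.
pose r := B1 t0 / m.+2%:R.
(* q1 completed by its limit at t0 *)
pose p t := if t == t0 then r else q1 t.
have m2 : m.+2%:R != 0 :> R by rewrite pnatr_eq0.
have cp : {for t0, continuous p}.
  apply/continuous_epsP => e e0; have pt0 : p t0 = r by rewrite /p eqxx.
  have /near_ball[d d0 Hd] : \forall t \near t0,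
      ((t != t0 -> is_derive t (1 : R) q (q1 t) /\
        (t - t0) * q1 t + m.+1%:R * q t = B t) /\
      `|B1 t - B1 t0| <= e) /\ is_derive t (1 : R) B (B1 t).
    by apply: filterI => //; apply: filterI => //; exact: cB10.
  apply: (ball_near d0) => t td; rewrite pt0 /p.
  case: ifPn => [_|tt0]; first by rewrite subrr normr0 ltW.
  have nz : t - t0 != 0 by rewrite subr_eq0.
  pose F x := (x - t0) ^+ m.+1 * (B x - m.+1%:R * q x) - r * (x - t0) ^+ m.+2.
  have -> : q1 t - r = F t / (t - t0) ^+ m.+2.
    have [[/(_ tt0)[_ Eq] _] _] := Hd _ td.
    rewrite /F -Eq addrK; rewrite !exprS; field.
    by rewrite nz expf_neq0.
  have F0 : F t0 = 0 by rewrite /F subrr !expr0n /= mul0r mulr0 subr0.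
  rewrite normrM normfV normrX ler_pdivrMr ?exprn_gt0 ?normr_gt0//.
  rewrite -[F t]subr0 -F0 exprSr mulrA.
  apply: (@mean_value_bound F (fun x => (x - t0) ^+ m.+1 * (B1 x - B1 t0))).
    have cX l : {for t0, continuous (fun x : R => (x - t0) ^+ l)}.
      apply: (@Cgerm_cont _ 0); apply: CgermX; apply: CgermD (Cgerm_id _ _) _.
      exact: Cgerm_cst.
    have cc (a : R) : {for t0, continuous (fun=> a)} by exact: cst_continuous.
    have c1 := continuousB cB0 (continuousM (cc m.+1%:R) cq).
    exact: (continuousB (continuousM (cX m.+1) c1) (continuousM (cc r) (cX m.+2))).
  move=> x xt0 xt; have [[/(_ xt0)[dq Eq] B1x] dBx] := Hd x (le_lt_trans xt td).
  split; last first.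
    rewrite normrM normrX mulrC; apply: ler_pM => //.
    by rewrite ler_pXn2r// ?nnegrE.
  have dx l : is_derive x (1 : R) (fun x => (x - t0) ^+ l) (l%:R * (x - t0) ^+ l.-1 * 1).
    exact/is_deriveX_pt/is_derive_subc.
  apply: (is_derive_eq (is_deriveB_pt (is_deriveM_pt (dx m.+1)
    (is_deriveB_pt dBx (is_deriveMl_pt m.+1%:R dq))) (is_deriveMl_pt r (dx m.+2)))).
  have -> : B1 t0 = r * m.+2%:R by rewrite divfK.
  rewrite /= -Eq !exprS; ring.
exists p.
  have dqn : \forall t \near t0, t != t0 -> is_derive t (1 : R) q (p t).
    by apply: filterS ode => t H tt0; rewrite /p (negbTE tt0); have [] := H tt0.
  have := is_derive_extend cq cp dqn => dq0.
  by apply: filterS dqn => t; have [->|tt0 /(_ isT)] := eqVneq t t0.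
apply: (IH m.+1 p (fun t => (B1 t - m.+2%:R * q1 t) / (t - t0)) B1) => //.
have ode1 := near_join ode.
near=> t => tt0; have nz : t - t0 != 0 by rewrite subr_eq0.
have dBt : is_derive t (1 : R) B (B1 t) by near: t.
have [dqt odet] : is_derive t (1 : R) q (q1 t) /\
     (t - t0) * q1 t + m.+1%:R * q t = B t by move: tt0; near: t.
split; last first.
  by rewrite /p (negbTE tt0); field.
have neart : \near t, t != t0.
  exact: near_neq.
apply: (@near_eq_is_derive _ _ _ (fun x => (B x - m.+1%:R * q x) * (x - t0)^-1)).
  have : \forall x \near t, x != t0 -> is_derive x (1 : R) q (q1 x) /\
     (x - t0) * q1 x + m.+1%:R * q x = B x by near: t.
  apply: filter_app; apply: filterS neart => x xt0 /(_ xt0)[_ <-].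
  by rewrite /p (negbTE xt0) addrK mulrAC divff ?mul1r// subr_eq0.
apply: (is_derive_eq (is_deriveM_pt (is_deriveB_pt dBt
  (is_deriveMl_pt m.+1%:R dqt)) (is_derive_subcV nz))).
rewrite -odet; field.
by rewrite nz.
Unshelve. all: by end_near. Qed.

(** For b = (t - t0) q one has b' = (t - t0) q' + q, the equation above with
    m = 0. *)
Lemma Cgerm_div j b q t0 : Cgerm j.+1 b t0 -> {for t0, continuous q} ->
  (\forall t \near t0, b t = (t - t0) * q t) -> Cgerm j q t0.
Proof.
move=> [b1 db cb1] cq bq.
apply: (@Cgerm_hadamard_ode j 0 q (fun t => (b1 t - q t) / (t - t0)) b1) => //.
have bq1 := near_join bq.
near=> t => tt0; have nz : t - t0 != 0 by rewrite subr_eq0.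
have dbt : is_derive t (1 : R) b (b1 t) by near: t.
have bqt : b t = (t - t0) * q t by near: t.
split; last by field.
have neart : \near t, t != t0.
  exact: near_neq.
apply: (@near_eq_is_derive _ _ _ (fun x => b x * (x - t0)^-1)).
  have : \forall x \near t, b x = (x - t0) * q x by near: t.
  apply: filter_app; apply: filterS neart => x xt0 ->.
  by rewrite mulrAC divff ?mul1r// subr_eq0.
apply: (is_derive_eq (is_deriveM_pt dbt (is_derive_subcV nz))).
rewrite bqt; field.
by rewrite nz.
Unshelve. all: by end_near. Qed.

End HadamardDivision.

(** * Weighted coefficient norms of polynomials *)

Section WeightedNorm.
Context {R : realType}.
Implicit Types (p q : {poly R}) (r s x y : R).

(** The norm of the Banach algebra of power series converging absolutely on the
    closed disc of radius r; it controls polynomials of unbounded degree. *)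
Definition wnorm r p : R := \sum_(i < size p) `|p`_i| * r ^+ i.

Lemma wnorm_widen r p n : (size p <= n)%N -> wnorm r p = \sum_(i < n) `|p`_i| * r ^+ i.
Proof.
move=> pn; rewrite /wnorm (big_ord_widen n (fun i => `|p`_i| * r ^+ i)) // big_mkcond.
apply: eq_bigr => i _; case: ifPn => //; rewrite -leqNgt => le.
by rewrite nth_default// normr0 mul0r.
Qed.

Lemma wnorm_ge0 r p : 0 <= r -> 0 <= wnorm r p.
Proof. by move=> r0; apply: sumr_ge0 => i _; rewrite mulr_ge0// exprn_ge0. Qed.

Lemma wnorm_cons r p a : wnorm r (p * 'X + a%:P) = wnorm r p * r + `|a|.
Proof.
rewrite (@wnorm_widen _ _ (size p).+1); last first.
  apply: leq_trans (size_polyD _ _) _; rewrite geq_max; apply/andP; split.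
    apply: leq_trans (size_polyMleq _ _) _.
    by rewrite size_polyX addn2.
  by apply: leq_trans (size_polyC_leq1 _) _.
rewrite big_ord_recl /= addrC coefD coefMX coefC eqxx add0r expr0 mulr1; congr (_ + _).
rewrite /wnorm mulr_suml; apply: eq_bigr => i _.
by rewrite coefD coefMX coefC /= addr0 exprSr mulrA.
Qed.

Lemma wnorm0 r : wnorm r 0 = 0.
Proof. by rewrite /wnorm size_poly0 big_ord0. Qed.

Lemma wnormC r a : wnorm r a%:P = `|a|.
Proof. by rewrite -[a%:P]add0r -(mul0r 'X) wnorm_cons wnorm0 mul0r add0r. Qed.

Lemma wnormMX r p : wnorm r (p * 'X) = wnorm r p * r.
Proof. by rewrite -[LHS](congr1 (wnorm r) (addr0 _)) -polyC0 wnorm_cons normr0 addr0. Qed.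

Lemma wnormZ r a p : wnorm r (a *: p) = `|a| * wnorm r p.
Proof.
rewrite (@wnorm_widen r (a *: p) (size p)) ?size_scale_leq// /wnorm mulr_sumr.
by apply: eq_bigr => i _; rewrite coefZ normrM mulrA.
Qed.

Lemma wnormN r p : wnorm r (- p) = wnorm r p.
Proof. by rewrite -scaleN1r wnormZ normrN1 mul1r. Qed.

Lemma wnormD r p q : 0 <= r -> wnorm r (p + q) <= wnorm r p + wnorm r q.
Proof.
move=> r0; pose n := maxn (size p) (size q).
rewrite (@wnorm_widen _ _ n) ?size_polyD// (@wnorm_widen _ p n) ?leq_maxl//.
rewrite (@wnorm_widen _ q n) ?leq_maxr// -big_split; apply: ler_sum => i _.
by rewrite /= -mulrDl coefD ler_wpM2r ?exprn_ge0// ler_normD.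
Qed.

Lemma wnormM r p q : 0 <= r -> wnorm r (p * q) <= wnorm r p * wnorm r q.
Proof.
move=> r0; elim/poly_ind: p => [|p c IH]; first by rewrite !mul0r wnorm0 mul0r.
rewrite mulrDl mulrAC mul_polyC wnorm_cons [leRHS]mulrDl.
apply: le_trans (wnormD _ _ r0) _; rewrite wnormMX wnormZ lerD2r mulrAC.
exact: ler_wpM2r.
Qed.

Lemma wnormXn r p n : 0 <= r -> wnorm r (p ^+ n) <= wnorm r p ^+ n.
Proof.
move=> r0; elim: n => [|n IH]; first by rewrite !expr0 -polyC1 wnormC normr1.
rewrite !exprS; apply: le_trans (wnormM _ _ r0) _.
by apply: ler_wpM2l => //; exact: wnorm_ge0.
Qed.

Lemma wnorm_sum r (n : nat) (F : nat -> {poly R}) : 0 <= r ->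
  wnorm r (\sum_(i < n) F i) <= \sum_(i < n) wnorm r (F i).
Proof.
move=> r0; elim: n => [|n IH]; first by rewrite !big_ord0 wnorm0.
by rewrite !big_ord_recr /=; apply: le_trans (wnormD _ _ r0) _; rewrite lerD2r.
Qed.

Lemma wnorm_le r s p : 0 <= r -> r <= s -> wnorm r p <= wnorm s p.
Proof.
move=> r0 rs; apply: ler_sum => i _; apply: ler_wpM2l => //.
by rewrite lerXn2r ?nnegrE// (le_trans r0).
Qed.

Lemma wnorm_comp r p q : 0 <= r -> wnorm r (p \Po q) <= wnorm (wnorm r q) p.
Proof.
move=> r0; have q0 := wnorm_ge0 q r0.
elim/poly_ind: p => [|p c IH]; first by rewrite comp_poly0 !wnorm0.
rewrite comp_polyD comp_polyM comp_polyX comp_polyC wnorm_cons.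
apply: le_trans (wnormD _ _ r0) _; rewrite wnormC lerD2r.
by apply: le_trans (wnormM _ _ r0) _; exact: ler_wpM2r.
Qed.

Lemma wnorm_horner r p x : `|x| <= r -> `|p.[x]| <= wnorm r p.
Proof.
move=> xr; elim/poly_ind: p => [|p c IH]; first by rewrite horner0 normr0 wnorm0.
rewrite !hornerE wnorm_cons; apply: le_trans (ler_normD _ _) _; rewrite lerD2r.
by rewrite normrM; exact: ler_pM.
Qed.

(** Halving the radius absorbs the exponent in the derivative of a monomial. *)
Lemma wnorm_lip r p x y : 0 < r -> `|x| <= r / 2 -> `|y| <= r / 2 ->
  `|p.[x] - p.[y]| * r <= 2 * wnorm r p * `|x - y|.
Proof.
move=> r0 xr yr; elim/poly_ind: p => [|p c IH].
  by rewrite !horner0 subrr normr0 wnorm0 mulr0 !mul0r.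
rewrite !hornerE wnorm_cons.
rewrite (_ : _ - _ = (p.[x] - p.[y]) * x + p.[y] * (x - y)); last by ring.
have py : `|p.[y]| <= wnorm r p.
  by apply: wnorm_horner; apply: le_trans yr _; rewrite ler_pdivrMr//; lra.
have : `|(p.[x] - p.[y]) * x + p.[y] * (x - y)| <=
    `|p.[x] - p.[y]| * (r / 2) + wnorm r p * `|x - y|.
  apply: le_trans (ler_normD _ _) _; rewrite !normrM.
  by apply: lerD; [exact: ler_wpM2l | exact: ler_wpM2r].
have := normr_ge0 (x - y); have := normr_ge0 c; have N0 := wnorm_ge0 p (ltW r0).
move=> c0 xy0 /(ler_wpM2r (ltW r0)) H; apply: le_trans H _.
have cxy := mulr_ge0 c0 xy0; nra.
Qed.

(** The linear gain in s / r makes compositions and Picard iterations contract on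
    small discs. *)
Lemma wnorm_scale r s p : 0 <= s -> s <= r -> 0 < r -> p.[0] = 0 ->
  wnorm s p <= s / r * wnorm r p.
Proof.
move=> s0 sr r0 p0.
have /factor_theorem[q ->] : root p 0 by apply/rootP.
rewrite subr0 !wnormMX.
have -> : s / r * (wnorm r q * r) = wnorm r q * s by field; rewrite gt_eqF.
by apply: ler_wpM2r => //; exact: wnorm_le.
Qed.

Lemma horner_le_wnorm r p x : 0 < r -> `|x| <= r -> p.[0] = 0 ->
  `|p.[x]| <= `|x| / r * wnorm r p.
Proof.
move=> r0 xr p0; apply: le_trans (wnorm_horner p (lexx _)) _.
exact: wnorm_scale.
Qed.

End WeightedNorm.

(** * Analytic germs through polynomial approximation *)

Section AnalyticGerm.
Context {R : realType}.
Implicit Types (f g b y z : R -> R) (p q : nat -> {poly R}) (t r M : R).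

(** Analyticity in terms of polynomials p J approximating f to order J at a
    geometric rate, with bounded norms but degrees of any size. The p J are not
    required to be truncations of each other, so products, composites and Picard
    iterates are approximated by the same operations on the p J; a power series
    is extracted only once, in analytic_power_series. *)
Definition approx f t0 r M p : Prop := 0 < r /\ forall J,
  wnorm r (p J) <= M /\
  forall h : R, `|h| <= r -> `|f (t0 + h) - (p J).[h]| <= M * (`|h| / r) ^+ J.

Definition analytic_germ f t0 : Prop := exists r M p, approx f t0 r M p.

Lemma approx_M0 f t0 r M p : approx f t0 r M p -> 0 <= M.
Proof. by move=> [r0 /(_ 0%N)[+ _]]; apply: le_trans; exact/wnorm_ge0/ltW. Qed.

Lemma approx_weaken f t0 r M p r' M' : approx f t0 r M p ->
  0 < r' -> r' <= r -> M <= M' -> approx f t0 r' M' p.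
Proof.
move=> A r'0 rr MM; have M0 := approx_M0 A; case: A => r0 A.
split => // J; have [A1 A2] := A J; split.
  by apply: le_trans MM; apply: le_trans A1; apply: wnorm_le => //; exact: ltW.
move=> h hr; apply: le_trans (A2 _ (le_trans hr rr)) _.
apply: ler_pM => //; first by rewrite exprn_ge0// divr_ge0// ltW.
rewrite lerXn2r ?nnegrE ?divr_ge0// ?(ltW r0) ?(ltW r'0)//.
by apply: ler_wpM2l => //; rewrite lef_pV2 ?posrE.
Qed.

Lemma approx_eq f g t0 r M p : approx f t0 r M p ->
  (forall h, `|h| <= r -> f (t0 + h) = g (t0 + h)) -> approx g t0 r M p.
Proof.
move=> [r0 A] fg; split => // J; have [A1 A2] := A J.
by split => // h hr; rewrite -fg//; exact: A2.
Qed.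

Lemma near_radius (P : R -> Prop) t0 r : 0 < r -> (\forall t \near t0, P t) ->
  exists s, [/\ 0 < s, s <= r & forall h, `|h| <= s -> P (t0 + h)].
Proof.
move=> r0 /near_ball[e e0 H]; exists (Num.min r (e / 2)); split.
- by rewrite lt_min r0 divr_gt0.
- by rewrite ge_min lexx.
- move=> h; rewrite le_min => /andP[_ he]; apply: H.
  by rewrite addrC addKr; lra.
Qed.

Lemma analytic_eq f g t0 : (\forall t \near t0, f t = g t) ->
  analytic_germ f t0 -> analytic_germ g t0.
Proof.
move=> fg [r [M [p A]]]; have [r0 _] := A.
have [s [s0 sr H]] := near_radius r0 fg.
by exists s, M, p; apply: approx_eq H; exact: approx_weaken A _ _ _.
Qed.

Lemma analytic_cst (a : R) t0 : analytic_germ (fun=> a) t0.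
Proof.
exists 1, `|a|, (fun=> a%:P); split => // J; split; first by rewrite wnormC.
move=> h h1; by rewrite hornerC subrr normr0 mulr_ge0// exprn_ge0// divr_ge0.
Qed.

Lemma analytic_id t0 : analytic_germ (fun t => t) t0.
Proof.
exists 1, (1 + `|t0|), (fun=> 1 * 'X + t0%:P); split => // J; split.
  by rewrite wnorm_cons -polyC1 wnormC normr1 mulr1.
move=> h h1; rewrite !hornerE (_ : _ - _ = 0); last by ring.
by rewrite normr0 mulr_ge0 ?addr_ge0 ?exprn_ge0 ?divr_ge0.
Qed.

Lemma approx2 f g t0 : analytic_germ f t0 -> analytic_germ g t0 ->
  exists r M p q, approx f t0 r M p /\ approx g t0 r M q.
Proof.
move=> [r [M [p A]]] [s [N [q B]]]; have [r0 _] := A; have [s0 _] := B.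
have m0 : 0 < Num.min r s by rewrite lt_min r0.
exists (Num.min r s), (Num.max M N), p, q; split.
  by apply: approx_weaken A _ _ _; rewrite ?ge_min ?le_max ?lexx.
by apply: approx_weaken B _ _ _; rewrite ?ge_min ?le_max ?lexx ?orbT.
Qed.

Lemma analytic_D f g t0 : analytic_germ f t0 -> analytic_germ g t0 ->
  analytic_germ (fun t => f t + g t) t0.
Proof.
move=> af ag; have [r [M [p [q [[r0 A] [_ B]]]]]] := approx2 af ag.
exists r, (M + M), (fun J => p J + q J); split => // J.
have [A1 A2] := A J; have [B1 B2] := B J; split.
  by apply: le_trans (wnormD _ _ (ltW r0)) _; exact: lerD.
move=> h hr; rewrite hornerD opprD addrACA mulrDl.
by apply: le_trans (ler_normD _ _) _; apply: lerD; auto.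
Qed.

Lemma approx_bound f t0 r M p h : approx f t0 r M p -> `|h| <= r ->
  `|f (t0 + h)| <= 2 * M.
Proof.
move=> [r0 /(_ 0%N)[A1 A2]] hr.
rewrite -[f _](subrK (p 0%N).[h]); apply: le_trans (ler_normD _ _) _.
rewrite mulr_natl mulr2n; apply: lerD.
  by have := A2 h hr; rewrite expr0 mulr1.
exact: le_trans (wnorm_horner _ hr) _.
Qed.

Lemma analytic_M f g t0 : analytic_germ f t0 -> analytic_germ g t0 ->
  analytic_germ (fun t => f t * g t) t0.
Proof.
move=> af ag; have [r [M [p [q [FA GA]]]]] := approx2 af ag.
have [r0 A] := FA; have [_ B] := GA; have M0 := approx_M0 FA.
exists r, (3 * M ^+ 2), (fun J => p J * q J); split => // J.
have [A1 A2] := A J; have [B1 B2] := B J; split.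
  apply: le_trans (wnormM _ _ (ltW r0)) _.
  have : wnorm r (p J) * wnorm r (q J) <= M * M.
    by apply: ler_pM => //; exact/wnorm_ge0/ltW.
  by move=> /le_trans; apply; rewrite expr2; nra.
move=> h hr; rewrite hornerM.
have -> : f (t0 + h) * g (t0 + h) - (p J).[h] * (q J).[h] =
  (f (t0 + h) - (p J).[h]) * g (t0 + h) + (p J).[h] * (g (t0 + h) - (q J).[h]).
  by ring.
apply: le_trans (ler_normD _ _) _; rewrite !normrM.
set e := (_ / _) ^+ _.
have -> : 3 * M ^+ 2 * e = (M * e) * (2 * M) + M * (M * e) by ring.
apply: lerD; apply: ler_pM => //.
- exact: A2.
- exact: approx_bound GA hr.
- exact: le_trans (wnorm_horner _ hr) _.
- exact: B2.
Qed.

Lemma analytic_N f t0 : analytic_germ f t0 -> analytic_germ (fun t => - f t) t0.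
Proof.
move=> af; apply: (@analytic_eq (fun t => (-1) * f t)); last first.
  by apply: analytic_M => //; exact: analytic_cst.
by near=> t; rewrite mulN1r.
Unshelve. all: by end_near. Qed.

Lemma analytic_sum (n : nat) (F : nat -> R -> R) t0 :
  (forall i, (i < n)%N -> analytic_germ (F i) t0) ->
  analytic_germ (fun t => \sum_(i < n) F i t) t0.
Proof.
elim: n => [|n IH] H.
  by apply: (@analytic_eq (fun=> 0)); [near=> t; rewrite big_ord0 | exact: analytic_cst].
apply: (@analytic_eq (fun t => \sum_(i < n) F i t + F n t)).
  by near=> t; rewrite big_ord_recr.
by apply: analytic_D; [apply: IH => i ?; apply: H; exact: ltnW | exact: H].
Unshelve. all: by end_near. Qed.

Lemma approx_center f t0 r M p J : approx f t0 r M p -> (p J.+1).[0] = f t0.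
Proof.
move=> [r0 /(_ J.+1)[_ /(_ 0)]]; rewrite normr0 (ltW r0) => /(_ isT).
by rewrite mul0r expr0n /= mulr0 addr0 normr_le0 subr_eq0 => /eqP.
Qed.

Lemma approx_lip f t0 r M p h : approx f t0 r M p -> `|h| <= r / 2 ->
  `|f (t0 + h) - f t0| <= 3 * M / r * `|h|.
Proof.
move=> A hr; have E := approx_center 0 A; case: A => r0 /(_ 1%N)[A1 A2].
have hr' : `|h| <= r by apply: le_trans hr _; rewrite ler_pdivrMr//; lra.
have L := @wnorm_lip _ r (p 1%N) h 0 r0 hr.
rewrite normr0 divr_ge0 ?(ltW r0)// subr0 E in L; have {}L := L isT.
have {A2}E2 := A2 h hr'; rewrite expr1 in E2.
have h0 := normr_ge0 h.
have L2 : `|(p 1%N).[h] - f t0| <= 2 * M / r * `|h|.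
  rewrite mulrAC ler_pdivlMr//; apply: le_trans L _.
  by apply: ler_wpM2r => //; rewrite ler_pM2l.
rewrite -[f (t0 + h)](subrK (p 1%N).[h]) -addrA.
apply: le_trans (ler_normD _ _) _; apply: le_trans (lerD E2 L2) _.
by rewrite le_eqVlt; apply/orP; left; apply/eqP; field; rewrite gt_eqF.
Qed.

Lemma analytic_lip f t0 : analytic_germ f t0 ->
  exists C : R, \forall t \near t0, `|f t - f t0| <= C * `|t - t0|.
Proof.
move=> [r [M [p A]]]; have [r0 _] := A; exists (3 * M / r).
apply: (@ball_near _ _ _ (r / 2)); first by rewrite divr_gt0.
move=> t tr; have -> : f t = f (t0 + (t - t0)) by rewrite addrC subrK.
by apply: approx_lip A _; exact: ltW.
Qed.

Lemma lip_cont f t0 (C : R) :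
  (\forall t \near t0, `|f t - f t0| <= C * `|t - t0|) -> {for t0, continuous f}.
Proof.
move=> H; apply/continuous_epsP => e e0.
have C0 : 0 < `|C| + 1 by rewrite ltr_wpDl.
have : \forall t \near t0, `|t - t0| < e / (`|C| + 1).
  by apply: (@ball_near _ _ _ (e / (`|C| + 1))) => //; rewrite divr_gt0.
apply: filter_app; apply: filterS H => t H te.
apply: le_trans H _; rewrite ltr_pdivlMr// in te; apply: le_trans (ltW te).
rewrite mulrC; apply: ler_wpM2l => //; apply: le_trans (ler_norm _) _.
by rewrite lerDl.
Qed.

Lemma analytic_cont f t0 : analytic_germ f t0 -> {for t0, continuous f}.
Proof. by move=> /analytic_lip[C]; exact: lip_cont. Qed.

End AnalyticGerm.

(** * Quotients and composites of analytic germs *)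

Section AnalyticClosure.
Context {R : realType}.
Implicit Types (f g b q y z : R -> R) (t r M : R).

(** The constant terms of the approximants of b vanish, so they can be divided by
    the variable, at the price of one order. *)
Lemma analytic_div b q t0 : analytic_germ b t0 -> {for t0, continuous q} ->
  (\forall t \near t0, b t = (t - t0) * q t) -> analytic_germ q t0.
Proof.
move=> [r [M [p A]]] cq bq; have [r0 _] := A.
have [s [s0 sr H]] := near_radius r0 bq.
have {A} : approx b t0 s M p by apply: approx_weaken A _ _ _.
move=> {r r0 sr bq} A; have M0 := approx_M0 A; have pc J := approx_center J A.
have b0 : b t0 = 0.
  by have := H 0; rewrite normr0 (ltW s0) addr0 subrr mul0r; apply.
have /boolp.choice[d Hd] : forall J, exists d, p J.+1 = d * 'X.
  move=> J; have /factor_theorem[d ->] : root (p J.+1) 0.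
    by apply/rootP; rewrite pc b0.
  by exists d; rewrite subr0.
have [_ {}A] := A.
have bound J h : `|h| <= s -> h != 0 ->
    `|q (t0 + h) - (d J).[h]| <= M / s * (`|h| / s) ^+ J.
  move=> hs h0; have [_ /(_ h hs)] := A J.+1.
  rewrite H// (addrC t0) addrK Hd hornerMX [_ * h]mulrC -mulrBr normrM exprSr.
  rewrite (addrC h) (_ : M * _ = `|h| * (M / s * (`|h| / s) ^+ J)); last by ring.
  by rewrite ler_pM2l// normr_gt0.
exists s, (M / s), d; split => // J; split.
  by have [+ _] := A J.+1; rewrite Hd wnormMX ler_pdivlMr.
move=> h hs; have [->|h0] := eqVneq h 0; last exact: bound.
(* both sides are continuous in h, so the estimate extends to h = 0 *)
have cc (a : R) : {for t0, continuous (fun=> a)} by exact: cst_continuous.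
have ch : {for t0, continuous (fun t : R => t - t0)}.
  by apply: continuousB => //; exact: cvg_id.
pose u t := `|q t - (d J).[t - t0]|; pose v t := M / s * (`|t - t0| / s) ^+ J.
suff : u t0 <= v t0 by rewrite /u /v subrr addr0.
have /continuous_withinNx cu : {for t0, continuous u}.
  have cd : {for t0, continuous (fun t => (d J).[t - t0])}.
    apply: (@continuous_comp _ _ _ (fun t => t - t0) (horner (d J))) => //.
    exact: continuous_horner.
  exact: (cvg_norm (continuousB cq cd)).
have /continuous_withinNx cv : {for t0, continuous v}.
  have cn : {for t0, continuous (fun x : R => `|x - t0| / s)}.
    exact: (continuousM (cvg_norm ch) (cc s^-1)).
  have cX : {for t0, continuous (fun x : R => (`|x - t0| / s) ^+ J)}.
    exact: (continuous_comp cn (@exprn_continuous _ J _)).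
  exact: (continuousM (cc _) cX).
apply: (ler_cvg_to cu cv).
rewrite near_withinE; apply: (@ball_near _ _ _ s) => // t ts tt0.
have e : t0 + (t - t0) = t by rewrite addrC subrK.
by have := bound J (t - t0) (ltW ts); rewrite subr_eq0 e => /(_ tt0).
Qed.

(** The approximants of g - g t0 have no constant term, hence on a small disc their
    norm drops below half the radius on which f is approximated. *)
Lemma analytic_comp f g t0 : analytic_germ f (g t0) -> analytic_germ g t0 ->
  analytic_germ (f \o g) t0.
Proof.
move=> [rho [M [p F]]] [r [N [q G]]].
have M0 := approx_M0 F; have N0 := approx_M0 G.
have qc J := approx_center J G.
have [rho0 FA] := F; have [r0 GA] := G.
pose q' J := q J.+1 - (g t0)%:P.
pose N' := N + `|g t0|.
have N'0 : 0 <= N' by rewrite addr_ge0.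
pose K := N + N' + 1; have K0 : 0 < K by rewrite /K; lra.
have q'0 J : (q' J).[0] = 0 by rewrite /q' !hornerE qc subrr.
have Nq' J : wnorm r (q' J) <= N'.
  apply: le_trans (wnormD _ _ (ltW r0)) _; rewrite wnormN wnormC lerD2r.
  by have [] := GA J.+1.
have gq J h : `|h| <= r -> `|g (t0 + h) - g t0 - (q' J).[h]| <= N * (`|h| / r) ^+ J.+1.
  move=> hr; have [_ /(_ h hr)] := GA J.+1.
  by rewrite /q' !hornerE opprB addrA subrK.
pose s := Num.min r (r * rho / (2 * K)).
have s0 : 0 < s by rewrite lt_min r0 divr_gt0 ?mulr_gt0.
have sr : s <= r by rewrite ge_min lexx.
have sK : s / r * K <= rho / 2.
  have sE : s <= r * rho / (2 * K) by rewrite ge_min lexx orbT.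
  rewrite mulrAC ler_pdivrMr//; apply: le_trans (ler_wpM2r (ltW K0) sE) _.
  by rewrite le_eqVlt; apply/orP; left; apply/eqP; field; rewrite gt_eqF.
have Nsq J : wnorm s (q' J) <= rho / 2.
  apply: le_trans (wnorm_scale (ltW s0) sr r0 (q'0 J)) _; apply: le_trans sK.
  apply: ler_wpM2l; first by rewrite divr_ge0// ltW.
  by apply: le_trans (Nq' J) _; rewrite /K; lra.
have hq J h : `|h| <= s -> `|(q' J).[h]| <= rho / 2.
  by move=> hs; apply: le_trans (wnorm_horner _ hs) _.
have gh h : `|h| <= s -> `|g (t0 + h) - g t0| <= `|h| / s * (rho / 2).
  move=> hs; have hr := le_trans hs sr.
  apply: (@le_trans _ _ (`|h| / r * K)).
    rewrite -[g _ - _](subrK (q' 0%N).[h]); apply: le_trans (ler_normD _ _) _.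
    have /le_trans := gq 0%N h hr; rewrite expr1 => E.
    have E2 := le_trans (horner_le_wnorm r0 hr (q'0 0%N))
      (ler_wpM2l (divr_ge0 (normr_ge0 h) (ltW r0)) (Nq' 0%N)).
    have := lerD (gq 0%N h hr) E2; rewrite expr1 => /le_trans; apply.
    rewrite mulrC -mulrDr; apply: ler_wpM2l; first by rewrite divr_ge0// ltW.
    by rewrite /K; lra.
  rewrite (_ : `|h| / r * K = `|h| / s * (s / r * K)); last first.
    by field; rewrite !gt_eqF.
  by apply: ler_wpM2l => //; rewrite divr_ge0// ltW.
exists s, (M + 2 * M / rho * N), (fun J => p J \Po q' J); split => // J.
have [F1 F2] := FA J.
have M1 : 0 <= 2 * M / rho * N.
  by rewrite mulr_ge0// divr_ge0 ?mulr_ge0// ltW.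
split.
  apply: le_trans (wnorm_comp _ _ (ltW s0)) _; apply: (@le_trans _ _ M); last by lra.
  apply: le_trans F1; apply: wnorm_le; first exact/wnorm_ge0/ltW.
  by apply: le_trans (Nsq J) _; lra.
move=> h hs; have hr := le_trans hs sr.
have hs1 : `|h| / s <= 1 by rewrite ler_pdivrMr// mul1r.
have hs0 : 0 <= `|h| / s by rewrite divr_ge0// ltW.
have ghr : `|g (t0 + h) - g t0| <= rho / 2.
  by apply: le_trans (gh h hs) _; apply: ler_piMl => //; rewrite divr_ge0// ltW.
rewrite horner_comp /= -{1}[g (t0 + h)](subrK (g t0)) (addrC _ (g t0)).
set x := g (t0 + h) - g t0 in ghr *.
rewrite -[f _](subrK (p J).[x]) -addrA mulrDl.
apply: le_trans (ler_normD _ _) _; apply: lerD.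
  apply: le_trans (F2 x _) _; first by apply: le_trans ghr _; lra.
  apply: ler_wpM2l => //; rewrite lerXn2r ?nnegrE ?divr_ge0// ?(ltW rho0) ?(ltW s0)//.
  rewrite ler_pdivrMr//; apply: le_trans (gh h hs) _; rewrite -/x.
  by apply: ler_wpM2l => //; lra.
have L := wnorm_lip (p J) rho0 ghr (hq J h hs).
rewrite -ler_pdivlMr// in L; apply: le_trans L _.
rewrite mulrAC [leRHS](_ : _ = 2 * M / rho * (N * (`|h| / s) ^+ J)); last by ring.
apply: ler_pM => //.
- by rewrite divr_ge0 ?mulr_ge0 ?wnorm_ge0// ltW.
- by rewrite ler_pM2r ?invr_gt0// ler_pM2l.
apply: le_trans (gq J h hr) _; apply: ler_wpM2l => //.
have hr0 : 0 <= `|h| / r by rewrite divr_ge0// ltW.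
apply: (@le_trans _ _ ((`|h| / r) ^+ J)).
  rewrite exprS; apply: ler_piMl; first by rewrite exprn_ge0.
  by rewrite ler_pdivrMr// mul1r.
rewrite lerXn2r ?nnegrE//; apply: ler_wpM2l => //.
by rewrite lef_pV2 ?posrE.
Qed.

End AnalyticClosure.

(** * Analytic simple roots *)

Section AnalyticRoot.
Context {R : realType}.
Implicit Types (f g b q y z : R -> R) (t r M : R).

Lemma approx_family n (c : nat -> R -> R) t0 :
  (forall i, (i < n)%N -> analytic_germ (c i) t0) ->
  exists r M (p : nat -> nat -> {poly R}), [/\ 0 < r, 0 <= M &
    forall i, (i < n)%N -> approx (c i) t0 r M (p i)].
Proof.
elim: n => [|n IH] H; first by exists 1, 0, (fun=> fun=> 0).
have [r [M [p [r0 M0 A]]]] := IH (fun i ni => H i (ltnW ni)).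
have [s [N [q B]]] := H n (ltnSn n); have [s0 _] := B.
have m0 : 0 < Num.min r s by rewrite lt_min r0.
exists (Num.min r s), (Num.max M N), (fun i => if i == n then q else p i).
split => // [|i]; first by rewrite le_max M0.
rewrite ltnS leq_eqVlt; case: eqVneq => [-> _|_ /= ni].
  by apply: approx_weaken B _ _ _; rewrite ?ge_min ?le_max ?lexx ?orbT.
by apply: approx_weaken (A i ni) _ _ _; rewrite ?ge_min ?le_max ?lexx.
Qed.

Lemma normX_lip (x y s : R) n : `|x| <= s -> `|y| <= s ->
  `|x ^+ n.+1 - y ^+ n.+1| <= n.+1%:R * s ^+ n * `|x - y|.
Proof.
move=> xs ys; have s0 : 0 <= s by exact: le_trans xs.
rewrite subrXX normrM mulrC; apply: ler_wpM2r => //.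
apply: le_trans (ler_norm_sum _ _ _) _.
apply: (@le_trans _ _ (\sum_(i < n.+1) s ^+ n)); last first.
  by rewrite sumr_const card_ord mulr_natl.
apply: ler_sum => i _; rewrite normrM !normrX.
have ii : (i <= n)%N by rewrite -ltnS.
rewrite -[in leRHS](subnK ii) exprD /=.
by apply: ler_pM; rewrite ?exprn_ge0// lerXn2r ?nnegrE.
Qed.

(** The Picard iterates q (J + 1) = sum_i p i (J + 1) * (q J)^i approximate z.
    Since c 0 and c 1 vanish at t0, the iteration preserves a small ball for the
    norm of a small disc. The error at order J + 1 is the truncation error of the
    coefficients plus the error at order J times a factor of size |h|; this
    factor is what yields the geometric rate. *)
Lemma analytic_fixpoint n (c : nat -> R -> R) z t0 :
  (forall i, (i < n)%N -> analytic_germ (c i) t0) ->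
  c 0%N t0 = 0 -> c 1%N t0 = 0 ->
  (exists C : R, \forall t \near t0, `|z t| <= C * `|t - t0|) ->
  (\forall t \near t0, z t = \sum_(i < n) c i t * z t ^+ i) ->
  analytic_germ z t0.
Proof.
move=> /approx_family[r [M [p [r0 M0 A]]]] c00 c10 [C0 zC0] fixz.
pose C := `|C0|; have C_ge0 : 0 <= C by exact: normr_ge0.
have zC : \forall t \near t0, `|z t| <= C * `|t - t0|.
  by apply: filterS zC0 => t zt; apply: le_trans zt _; rewrite ler_wpM2r// ler_norm.
pose K := n%:R * M + 1; have K1 : 1 <= K by rewrite /K lerDr mulr_ge0.
have K0 : 0 < K by lra.
have pc i J : (i < n)%N -> (i < 2)%N -> (p i J.+1).[0] = 0.
  by move=> ni; rewrite (approx_center J (A i ni)); case: i ni => [|[|]].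
pose rho := K^-1; have rho0 : 0 < rho by rewrite invr_gt0.
have rho1 : rho <= 1 by rewrite invf_le1.
pose s := r * rho / K; have s0 : 0 < s by rewrite divr_gt0// mulr_gt0.
have sr : s <= r.
  rewrite ler_pdivrMr//; apply: ler_wpM2l; first exact: ltW.
  exact: le_trans K1.
pose q := fix q J : {poly R} :=
  if J is J'.+1 then \sum_(i < n) p i J'.+1 * q J' ^+ i else 0.
have q0 J : (q J).[0] = 0.
  elim: J => [|J IH]; first by rewrite horner0.
  rewrite /= horner_sum big1// => i _; rewrite hornerM horner_exp IH.
  case: (ltnP i 1) => [i1|i1]; last by rewrite expr0n gtn_eqF// mulr0.
  by rewrite pc ?mul0r// (leq_trans i1).
(* each of the n summands has norm at most M rho / K *)
have Nq J : wnorm s (q J) <= rho.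
  elim: J => [|J IH]; first by rewrite wnorm0 ltW.
  apply: le_trans (@wnorm_sum _ s n (fun i => p i J.+1 * q J ^+ i) (ltW s0)) _.
  apply: (@le_trans _ _ (\sum_(i < n) M * (rho / K))); last first.
    rewrite sumr_const card_ord -mulr_natl mulrA (_ : _ * M = K - 1); last first.
      by rewrite /K addrK.
    rewrite mulrBl mul1r mulrCA divff ?gt_eqF// mulr1.
    by rewrite gerBl divr_ge0// ltW.
  apply: ler_sum => i _; have [_ /(_ J.+1)[Ai _]] := A i (ltn_ord i).
  apply: le_trans (wnormM _ _ (ltW s0)) _.
  have Nqi : wnorm s (q J ^+ i) <= rho ^+ i.
    apply: le_trans (wnormXn _ _ (ltW s0)) _; rewrite lerXn2r ?nnegrE ?(ltW rho0)//.
    exact/wnorm_ge0/ltW.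
  apply: (@le_trans _ _ (wnorm s (p i J.+1) * rho ^+ i)).
    by apply: ler_wpM2l => //; exact/wnorm_ge0/ltW.
  case: (ltnP i 2) => [i2|i2].
    apply: (@le_trans _ _ (wnorm s (p i J.+1))).
      apply: ler_piMr; first exact/wnorm_ge0/ltW.
      by rewrite exprn_ile1// ltW.
    apply: le_trans (wnorm_scale (ltW s0) sr r0 (pc _ _ (ltn_ord i) i2)) _.
    rewrite (_ : s / r = rho / K); last by rewrite /s; field; rewrite !gt_eqF.
    by rewrite mulrC; apply: ler_wpM2r => //; rewrite divr_ge0// ltW.
  apply: ler_pM => //; first exact/wnorm_ge0/ltW.
  - by rewrite exprn_ge0// ltW.
  - exact: le_trans (wnorm_le _ (ltW s0) sr) Ai.
  - rewrite -(subnK i2) exprD -[K^-1]/rho -expr2.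
    by apply: ler_piMl; rewrite ?exprn_ge0 ?exprn_ile1// ltW.
have [s' [s'0 s's Hz]] := near_radius s0 (filterI zC fixz).
(* C1 * |h| bounds both z and q J at h; C2 * |h| is a Lipschitz constant, in z, of
   each summand *)
pose C1 := C + rho / s; have C1_ge0 : 0 <= C1 by rewrite addr_ge0 ?divr_ge0// ltW.
pose C2 := M / r + M * (n%:R * C1).
have C2_ge0 : 0 <= C2 by rewrite addr_ge0 ?divr_ge0 ?mulr_ge0// ltW.
pose L := 2 * n%:R * C2 + C1 + 1.
have nC2 : 0 <= n%:R * C2 by rewrite mulr_ge0.
have L1 : 1 <= L by rewrite /L; lra.
have L0 : 0 < L by lra.
pose s3 := Num.min s' L^-1.
have s30 : 0 < s3 by rewrite lt_min s'0 invr_gt0.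
have s3s : s3 <= s by rewrite ge_min s's.
have s3r : s3 <= r by exact: le_trans sr.
have s3L : s3 * L <= 1 by rewrite -ler_pdivlMr// div1r ge_min lexx orbT.
pose M3 := 2 * n%:R * M + C * s3 + 1.
have nM : 0 <= n%:R * M by rewrite mulr_ge0.
have Cs3 : 0 <= C * s3 by rewrite mulr_ge0// ltW.
exists s3, M3, q; split => // J; split.
  apply: le_trans (wnorm_le _ (ltW s30) s3s) _; apply: le_trans (Nq J) _.
  by rewrite /M3; lra.
move=> h hs3; have hs : `|h| <= s by exact: le_trans s3s.
have hr : `|h| <= r by exact: le_trans sr.
have h0 := normr_ge0 h.
have hs' : `|h| <= s' by apply: le_trans hs3 _; rewrite ge_min lexx.
have [] := Hz h hs'; rewrite addrAC subrr add0r => zh zfix.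
have C1h : C1 * `|h| <= 1.
  apply: le_trans s3L; rewrite mulrC; apply: ler_pM => //.
  by rewrite /L; lra.
have zC1 : `|z (t0 + h)| <= C1 * `|h|.
  apply: le_trans zh _; apply: ler_wpM2r => //.
  by rewrite lerDl divr_ge0// ltW.
have qC1 I : `|(q I).[h]| <= C1 * `|h|.
  apply: le_trans (horner_le_wnorm s0 hs (q0 I)) _.
  rewrite (_ : _ * wnorm _ _ = wnorm s (q I) / s * `|h|); last by ring.
  apply: ler_wpM2r => //; apply: (@le_trans _ _ (rho / s)).
    by rewrite ler_pM2r ?invr_gt0.
  by rewrite lerDr.
have e0 : 0 <= `|h| / s3 by rewrite divr_ge0// ltW.
elim: J => [|J IH].
  rewrite horner0 subr0 expr0 mulr1; apply: le_trans zh _.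
  apply: (@le_trans _ _ (C * s3)); first exact: ler_wpM2l.
  by rewrite /M3; lra.
rewrite zfix /= horner_sum -sumrB.
have term (i : 'I_n) : `|c i (t0 + h) * z (t0 + h) ^+ i - (p i J.+1 * q J ^+ i).[h]| <=
    M * (`|h| / r) ^+ J.+1 + C2 * `|h| * `|z (t0 + h) - (q J).[h]|.
  have [_ /(_ J.+1)[Ai1 /(_ h hr) Ai2]] := A i (ltn_ord i).
  rewrite hornerM horner_exp.
  set Z := z _ in zC1 IH *; set Q := (q J).[h] in IH *; set a := c i _ in Ai2 *.
  set P := (p i J.+1).[h] in Ai2 *.
  rewrite (_ : _ - _ = (a - P) * Z ^+ i + P * (Z ^+ i - Q ^+ i)); last by ring.
  apply: le_trans (ler_normD _ _) _; rewrite !normrM; apply: lerD.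
    rewrite -[leRHS]mulr1; apply: ler_pM => //.
    by rewrite normrX exprn_ile1//; exact: le_trans C1h.
  case ei : (nat_of_ord i) => [|k].
    by rewrite !expr0 subrr normr0 mulr0 !mulr_ge0.
  have ZQ := @normX_lip Z Q (C1 * `|h|) k zC1 (qC1 J).
  have Mr0 : 0 <= M / r by rewrite divr_ge0// ltW.
  have MnC : 0 <= M * (n%:R * C1) by rewrite !mulr_ge0.
  case: k ei ZQ => [|k] ei ZQ.
    rewrite !expr1; apply: ler_wpM2r => //.
    apply: le_trans (horner_le_wnorm r0 hr (pc _ _ (ltn_ord i) _)) _; first by rewrite ei.
    rewrite mulrAC -mulrA mulrC; apply: ler_wpM2r => //.
    apply: (@le_trans _ _ (M / r)); last by rewrite /C2 lerDl.
    by rewrite ler_pM2r ?invr_gt0.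
  apply: (@le_trans _ _ (M * (k.+2%:R * (C1 * `|h|) ^+ k.+1 * `|Z - Q|))).
    by apply: ler_pM => //; exact: le_trans (wnorm_horner _ hr) _.
  rewrite !mulrA; apply: ler_wpM2r => //.
  apply: (@le_trans _ _ (M * (n%:R * C1) * `|h|)); last first.
    by apply: ler_wpM2r => //; rewrite /C2 lerDr.
  rewrite (_ : M * (n%:R * C1) * `|h| = M * n%:R * (C1 * `|h|)); last by ring.
  apply: ler_pM.
  - by rewrite mulr_ge0.
  - by rewrite exprn_ge0// mulr_ge0.
  - by apply: ler_wpM2l => //; rewrite ler_nat -ei ltnW.
  - by rewrite exprS; apply: ler_piMr; rewrite ?mulr_ge0 ?exprn_ile1 ?mulr_ge0.
apply: le_trans (ler_norm_sum _ _ _) _; apply: le_trans (ler_sum _ (fun i _ => term i)) _.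
rewrite sumr_const card_ord -mulr_natl mulrDr !mulrA.
have E1 : (`|h| / r) ^+ J.+1 <= (`|h| / s3) ^+ J.+1.
  rewrite lerXn2r ?nnegrE ?divr_ge0// ?(ltW r0) ?(ltW s30)//.
  by apply: ler_wpM2l => //; rewrite lef_pV2 ?posrE.
have E2 : n%:R * C2 * `|h| * `|z (t0 + h) - (q J).[h]| <=
    M3 / 2 * (`|h| / s3) ^+ J.+1.
  apply: (@le_trans _ _ (n%:R * C2 * `|h| * (M3 * (`|h| / s3) ^+ J))).
    by apply: ler_wpM2l => //; rewrite mulr_ge0.
  rewrite exprS !mulrA; apply: ler_wpM2r; first by rewrite exprn_ge0.
  have M30 : 0 <= M3 by rewrite /M3; lra.
  rewrite (_ : n%:R * C2 * `|h| * M3 = (n%:R * C2) * (M3 * `|h|)); last by ring.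
  rewrite (_ : M3 / 2 * _ / _ = (2 * s3)^-1 * (M3 * `|h|)); last first.
    by field; rewrite gt_eqF.
  apply: ler_wpM2r; first by rewrite mulr_ge0.
  rewrite -div1r ler_pdivlMr ?mulr_gt0//; apply: le_trans s3L.
  rewrite (_ : _ * (2 * s3) = s3 * (2 * n%:R * C2)); last by ring.
  by apply: ler_wpM2l; [exact: ltW | rewrite /L; lra].
have E3 : n%:R * M * (`|h| / r) ^+ J.+1 <= M3 / 2 * (`|h| / s3) ^+ J.+1.
  apply: ler_pM => //; first by rewrite exprn_ge0// divr_ge0// ltW.
  by rewrite /M3; lra.
by apply: le_trans (lerD E3 E2) _; rewrite -mulrDl -splitr.
Qed.


(** Recentred at y t0 and divided by the derivative D, the equation becomes a
    fixed-point equation whose constant and linear coefficients vanish at t0. *)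
Lemma analytic_root n (b : nat -> R -> R) y t0 (C : R) :
  (forall i, (i < n)%N -> analytic_germ (b i) t0) ->
  (\forall t \near t0, `|y t - y t0| <= C * `|t - t0|) ->
  (\forall t \near t0, \sum_(i < n) b i t * y t ^+ i = 0) ->
  \sum_(i < n) b i t0 * (i%:R * y t0 ^+ i.-1) != 0 ->
  analytic_germ y t0.
Proof.
move=> ab yC root0; set D := \sum_(i < n) _ => D0.
pose y0 := y t0; pose z t := y t - y0.
(* coefficients of the equation recentred at y0 *)
pose e i t := \sum_(k < n) b k t * ('C(k, i)%:R * y0 ^+ (k - i)).
have ez t : \sum_(i < n) b i t * y t ^+ i = \sum_(i < n) e i t * z t ^+ i.
  under [RHS]eq_bigr do rewrite mulr_suml.
  rewrite exchange_big /=; apply: eq_bigr => k _.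
  have -> : y t = y0 + z t by rewrite /z addrC subrK.
  rewrite exprDn mulr_sumr.
  rewrite (big_ord_widen n (fun i => b k t * (y0 ^+ (k - i) * z t ^+ i *+ 'C(k, i))))//.
  rewrite big_mkcond; apply: eq_bigr => i _.
  case: ifPn => [_|]; first by rewrite -mulr_natl !mulrA.
  by rewrite -leqNgt => ki; rewrite bin_small// mul0r mulr0 mul0r.
have ae i : analytic_germ (e i) t0.
  apply: (@analytic_sum _ n (fun k t => b k t * ('C(k, i)%:R * y0 ^+ (k - i)))) => k kn.
  by apply: analytic_M; [exact: ab | exact: analytic_cst].
have e1 : e 1%N t0 = D.
  by apply: eq_bigr => k _; rewrite bin1 subn1.
have n1 : (1 < n)%N.
  apply: contraNT D0; rewrite -leqNgt => n1; apply/eqP/big1 => i _.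
  have -> : nat_of_ord i = 0%N.
    by apply/eqP; rewrite -leqn0 -ltnS; exact: leq_trans n1.
  by rewrite mul0r mulr0.
have z0 : z t0 = 0 by rewrite /z subrr.
have e0 : e 0%N t0 = 0.
  have := nbhs_singleton root0; rewrite ez z0.
  rewrite (bigD1 (Ordinal (ltnW n1)))//= expr0 mulr1 big1 ?addr0// => i i0.
  rewrite expr0n (_ : (nat_of_ord i == 0)%N = false) ?mulr0//.
  by apply: contraNF i0 => /eqP i0; apply/eqP/val_inj.
pose c i t := (i == 1%N)%:R - e i t / D.
apply: (@analytic_eq _ (fun t => z t + y0)).
  by near=> t; rewrite /z subrK.
apply: analytic_D; last exact: analytic_cst.
apply: (@analytic_fixpoint n c).
- move=> i ni; apply: analytic_D; first exact: analytic_cst.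
  by apply: analytic_N; apply: analytic_M => //; exact: analytic_cst.
- by rewrite /c e0 mul0r subr0.
- by rewrite /c e1 divff// subrr.
- by exists C; apply: filterS yC => t; rewrite /z.
apply: filterS root0 => t; rewrite ez => E.
rewrite /c; under eq_bigr do rewrite mulrBl mulrAC.
rewrite sumrB -mulr_suml E mul0r subr0.
rewrite (bigD1 (Ordinal n1))//= expr1 mul1r big1 ?addr0// => i i1.
rewrite (_ : (nat_of_ord i == 1)%N = false) ?mul0r//.
by apply: contraNF i1 => /eqP i1; apply/eqP/val_inj.
Unshelve. all: by end_near. Qed.

(** The inverse is the simple root of f * y - 1. *)
Lemma analytic_V f t0 : f t0 != 0 -> analytic_germ f t0 ->
  analytic_germ (fun t => (f t)^-1) t0.
Proof.
move=> f0 af; have [C fC] := analytic_lip af.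
have a0 : 0 < `|f t0| / 2 by rewrite divr_gt0 ?normr_gt0.
have /continuous_epsP/(_ _ a0) cf := analytic_cont af.
have nf := near_neq0 (analytic_cont af) f0.
pose b (i : nat) t : R := if i == 0%N then -1 else f t.
apply: (@analytic_root 2 b _ _ (C / (`|f t0| / 2 * `|f t0|))).
- by case=> [|i] _; rewrite /b /=; [exact: analytic_cst | exact: af].
- near=> t.
  have ft0 : f t != 0 by near: t.
  have fCt : `|f t - f t0| <= C * `|t - t0| by near: t.
  have cft : `|f t - f t0| <= `|f t0| / 2 by near: t.
  have ft : `|f t0| / 2 <= `|f t|.
    have := ler_distD (f t) (f t0) 0; rewrite !subr0 distrC; lra.
  rewrite (_ : _ - _ = (f t0 - f t) / (f t * f t0)); last by field; rewrite ft0 f0.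
  rewrite normrM normfV normrM distrC ler_pdivrMr ?mulr_gt0 ?normr_gt0//.
  have Ct : 0 <= C * `|t - t0| by exact: le_trans (normr_ge0 _) fCt.
  apply: le_trans fCt _.
  rewrite (_ : _ * (`|f t| * _) = C * `|t - t0| * (`|f t| / (`|f t0| / 2))); last first.
    by field; rewrite normr_eq0 f0.
  by apply: ler_peMr => //; rewrite ler_pdivlMr// mul1r.
- near=> t; have ft0 : f t != 0 by near: t.
  by rewrite !big_ord_recl big_ord0 /b /= expr0 mulr1 addr0 expr1 divff// addNr.
- by rewrite !big_ord_recl big_ord0 /b /= mul0r mulr0 add0r addr0 expr0 !mulr1.
Unshelve. all: by end_near. Qed.

End AnalyticRoot.

(** * Smoothness of curves, coordinate by coordinate *)

Section VectorCurves.
Context {R : realType}.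

Lemma cvg_colP n T (F : set_system T) (FF : Filter F) (u : T -> 'cV[R]_n)
    (l : 'cV[R]_n) :
  u @ F --> l <-> forall i, u x i 0 @[x --> F] --> l i 0.
Proof.
split=> [ul i|H].
  exact: (continuous_cvg _ (@coord_continuous R n 1 i 0 l) ul).
apply/cvgrPdist_le => /= e e0; near=> x.
rewrite /Num.Def.normr /= mx_normrE (bigmax_le _ (ltW e0)) //= => -[i j] _.
rewrite !mxE /= ord1; move: i {j}; near: x; apply: filter_forall => i.
exact: ((cvgrPdist_le _ _).1 (H i)).
Unshelve. all: by end_near. Qed.

Lemma is_derive_coord n (c : R -> 'cV[R]_n) t i : derivable c t 1 ->
  is_derive t (1 : R) (fun t => c t i 0) (derive1 c t i 0).
Proof.
move=> dc; have /derivable_mxP/(_ i 0) dci := dc.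
by apply: DeriveDef => //; rewrite derive1E derive_mx// mxE.
Qed.

Lemma class_Cn_S n j (c : R -> 'cV[R]_n) :
  class_Cn j.+1 c <-> (forall t, derivable c t 1) /\ class_Cn j (derive1 c).
Proof.
split=> [[dc cc]|[dc [dc1 cc]]].
  split=> [t|]; first exact: (dc 0%N).
  by split=> [i t ij|]; rewrite -derive1Sn//; exact: dc.
split=> [[|i] t ij|]; [exact: dc | |]; rewrite derive1Sn//; exact: dc1.
Qed.

Lemma class_Cn_germ n j (c : R -> 'cV[R]_n) :
  class_Cn j c <-> forall i t0, Cgerm j (fun t => c t i 0) t0.
Proof.
elim: j c => [|j IH] c.
  split=> [[_ cc] i t0|H].
    by near=> t; have /cvg_colP := cc t; exact.
  split=> // t; rewrite derive1n0; apply/cvg_colP => i.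
  exact: (nbhs_singleton (H i t)).
rewrite class_Cn_S IH; split=> [[dc H] i t0|H].
  exists (fun t => derive1 c t i 0) => //.
  by near=> t; exact: is_derive_coord.
have dc t : derivable c t 1.
  apply/derivable_mxP => i k; rewrite ord1; have [g dg _] := H i t.
  by case: (nbhs_singleton dg).
split=> // i t0; have [g dg] := H i t0; apply: Cgerm_eq.
apply: filterS dg => t [_ <-].
by have [_ ->] := is_derive_coord i (dc t).
Unshelve. all: by end_near. Qed.

End VectorCurves.

(** * Power series and analytic germs *)

Section PowerSeries.
Context {R : realType}.
Implicit Types (f : R -> R) (a : nat -> R).

Lemma sum_geometric_le2 (x : R) n : 0 <= x -> x <= 1 / 2 -> \sum_(i < n) x ^+ i <= 2.
Proof.
move=> x0 x2; have xn : 0 <= x ^+ n by exact: exprn_ge0.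
have S0 : 0 <= \sum_(i < n) x ^+ i by apply: sumr_ge0 => i _; exact: exprn_ge0.
have := subrX1 x n; nra.
Qed.

Lemma power_series_analytic a f (t0 : R) :
  (\forall t \near t0, series (fun j : nat => (t - t0) ^+ j * a j) @ \oo --> f t) ->
  analytic_germ f t0.
Proof.
move=> /near_ball[d d0 H]; pose r1 := d / 2.
have r10 : 0 < r1 by rewrite divr_gt0.
have [M M0 aM] : exists2 M : R, 0 <= M & forall j, `|a j| * r1 ^+ j <= M.
  have /H : `|t0 + r1 - t0| < d.
    by rewrite addrAC subrr add0r gtr0_norm// /r1; lra.
  rewrite addrAC subrr add0r => cv.
  have /cvg_series_cvg_0 c0 : cvgn (series (fun j => r1 ^+ j * a j)).
    by apply/cvg_ex; exists (f (t0 + r1)).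
  have /cvg_seq_bounded[N [_ HN]] : cvgn (fun j => r1 ^+ j * a j).
    by apply/cvg_ex; exists 0.
  have N1 : N < `|N| + 1 by apply: le_lt_trans (ler_norm _) _; rewrite ltrDl.
  exists (`|N| + 1) => [|j]; first by rewrite addr_ge0.
  by have /= := HN _ N1 j I; rewrite normrM normrX (gtr0_norm r10) mulrC.
pose p J := \poly_(j < J) a j.
pose r := r1 / 2; have r0 : 0 < r by rewrite divr_gt0.
exists r, (2 * M), p; split => // J; split.
  rewrite (@wnorm_widen _ _ _ J) ?size_poly//.
  apply: (@le_trans _ _ (\sum_(i < J) M * (1 / 2) ^+ i)).
    apply: ler_sum => i _; rewrite coef_poly ltn_ord.
    rewrite (_ : r = r1 * (1 / 2)); last by rewrite /r mulrA mulr1.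
    by rewrite exprMn mulrA ler_wpM2r// exprn_ge0.
  rewrite -mulr_sumr mulrC; apply: ler_wpM2r => //.
  by apply: sum_geometric_le2.
move=> h hr; have hd : `|t0 + h - t0| < d.
  by rewrite addrAC subrr add0r; apply: le_lt_trans hr _; rewrite /r /r1; lra.
have h0 := normr_ge0 h; have := H _ hd; rewrite addrAC subrr add0r => cv.
have pJ : (p J).[h] = \sum_(i < J) h ^+ i * a i.
  rewrite (horner_coef_wide h (size_poly _ _)); apply: eq_bigr => i _.
  by rewrite coef_poly ltn_ord mulrC.
have cJ : (fun N => `|series (fun j => h ^+ j * a j) N - (p J).[h]|) @ \oo -->
    `|f (t0 + h) - (p J).[h]|.
  by apply: cvg_norm; apply: cvgB => //; exact: cvg_cst.
apply: (cvgr_to_le cJ).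
exists J => // N /= JN; rewrite /series /= big_mkord.
rewrite -(subnKC JN) big_split_ord /= pJ addrAC subrr add0r.
apply: le_trans (ler_norm_sum _ _ _) _.
have hr1 : 0 <= `|h| / r1 by rewrite divr_ge0// ltW.
have hr2 : 0 <= `|h| / r by rewrite divr_ge0// ltW.
apply: (@le_trans _ _ (\sum_(i < N - J) M * (`|h| / r1) ^+ J * (`|h| / r1) ^+ i)).
  apply: ler_sum => i _; rewrite normrM normrX -mulrA -exprD expr_div_n mulrC.
  rewrite mulrA ler_pdivlMr ?exprn_gt0// mulrAC.
  by apply: ler_wpM2r; [exact: exprn_ge0 | exact: aM].
rewrite -mulr_sumr mulrC -[leRHS]mulrA.
apply: ler_pM; rewrite ?mulr_ge0 ?exprn_ge0//.
- by apply: sumr_ge0 => i _; exact: exprn_ge0.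
- apply: sum_geometric_le2 => //; rewrite ler_pdivrMr//.
  by apply: le_trans hr _; rewrite /r; lra.
- apply: ler_wpM2l => //; rewrite lerXn2r ?nnegrE//.
  by apply: ler_wpM2l => //; rewrite lef_pV2 ?posrE// /r; lra.
Qed.

(** Used on the difference of two approximants of order J, to see that they agree
    in degrees below J. *)
Lemma poly_vanish (d : {poly R}) (C r : R) J : 0 < r ->
  (forall h, h != 0 -> `|h| <= r -> `|d.[h]| <= C * `|h| ^+ J) ->
  forall i, (i < J)%N -> d`_i = 0.
Proof.
move=> r0; elim: J d => [//|J IH] d H.
have d0 : d.[0] = 0.
  pose u (h : R) := `|d.[h]|; pose v (h : R) := C * `|h| ^+ J.+1.
  have /continuous_withinNx cu : {for 0, continuous u}.
    exact: (cvg_norm (@continuous_horner _ d 0)).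
  have /continuous_withinNx cv : {for 0, continuous v}.
    have cn : {for 0, continuous (fun x : R => `|x|)} by exact: norm_continuous.
    apply: continuousM; first exact: cst_continuous.
    exact: (continuous_comp cn (@exprn_continuous _ J.+1 _)).
  have : u 0 <= v 0.
    apply: (ler_cvg_to cu cv); rewrite near_withinE.
    apply: (@ball_near _ _ _ r) => // h; rewrite subr0 => hr h0.
    by apply: H => //; exact: ltW.
  by rewrite /u /v normr0 expr0n mulr0 normr_le0 => /eqP.
have /factor_theorem[e de] : root d 0 by apply/rootP.
rewrite subr0 in de.
have He : forall h, h != 0 -> `|h| <= r -> `|e.[h]| <= C * `|h| ^+ J.
  move=> h h0 hr; have := H h h0 hr.
  by rewrite de hornerMX normrM exprSr mulrA ler_pM2r// normr_gt0.
by case=> [|i] iJ; rewrite de coefMX//=; exact: IH He _ _.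
Qed.

(** Approximants of order at least J share their coefficients in degrees below J,
    so the coefficient of degree j can be read off p (j + 1). *)
Lemma analytic_power_series f (t0 : R) : analytic_germ f t0 -> exists a : nat -> R,
  \forall t \near t0, series (fun j : nat => (t - t0) ^+ j * a j) @ \oo --> f t.
Proof.
move=> [r [M [p F]]]; have M0 := approx_M0 F; case: F => r0 F.
exists (fun j => (p j.+1)`_j).
have coh J K i : (J <= K)%N -> (i < J)%N -> (p K)`_i = (p J)`_i.
  move=> JK iJ; apply/eqP; rewrite -subr_eq0 -coefB; apply/eqP.
  apply: (@poly_vanish _ (2 * M * r^-1 ^+ J) r J) => // h h0 hr.
  have [_ /(_ h hr) F1] := F J; have [_ /(_ h hr) F2] := F K.
  rewrite hornerD hornerN (_ : _ - _ =
    (f (t0 + h) - (p J).[h]) - (f (t0 + h) - (p K).[h])); last by ring.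
  apply: le_trans (ler_normB _ _) _; apply: le_trans (lerD F1 F2) _.
  have hr0 : 0 <= `|h| / r by rewrite divr_ge0// ltW.
  have : (`|h| / r) ^+ K <= (`|h| / r) ^+ J.
    by apply: ler_wiXn2l => //; rewrite ler_pdivrMr// mul1r.
  move=> /(ler_wpM2l M0) E; apply: le_trans (lerD (lexx _) E) _.
  by rewrite exprMn le_eqVlt; apply/orP; left; apply/eqP; ring.
apply: (@ball_near _ _ _ r) => // t tr; set h := t - t0 in tr *.
have -> : f t = f (t0 + h) by rewrite /h addrC subrK.
have hr := ltW tr; have hr0 : 0 <= `|h| / r by rewrite divr_ge0// ltW.
have hr1 : `|h| / r <= 1 by rewrite ler_pdivrMr// mul1r.
have bound J : `|f (t0 + h) - series (fun j => h ^+ j * (p j.+1)`_j) J|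
    <= 2 * M * (`|h| / r) ^+ J.
  pose q := \poly_(i < J) (p J)`_i.
  have -> : series (fun j => h ^+ j * (p j.+1)`_j) J = q.[h].
    rewrite /series /= big_mkord (horner_coef_wide h (size_poly _ _)).
    apply: eq_bigr => i _; rewrite coef_poly ltn_ord mulrC; congr (_ * _).
    by rewrite (coh i.+1 J).
  have [F1 /(_ h hr) F2] := F J.
  have E : `|(p J - q).[h]| <= M * (`|h| / r) ^+ J.
    apply: le_trans (wnorm_horner _ (lexx _)) _.
    rewrite (@wnorm_widen _ _ _ (maxn J (size (p J)))); last first.
      apply: leq_trans (size_polyD _ _) _; rewrite size_polyN geq_max leq_maxr.
      by apply: leq_trans (size_poly _ _) (leq_maxl _ _).
    apply: le_trans (ler_wpM2r (exprn_ge0 _ hr0) F1).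
    rewrite (@wnorm_widen _ _ _ (maxn J (size (p J)))) ?leq_maxr// mulr_suml.
    apply: ler_sum => i _; rewrite coefB coef_poly.
    case: ltnP => iJ.
      by rewrite subrr normr0 mul0r !mulr_ge0 ?exprn_ge0// ltW.
    rewrite subr0 -mulrA; apply: ler_wpM2l => //.
    have -> : `|h| ^+ i = r ^+ i * (`|h| / r) ^+ i.
      by rewrite -exprMn mulrC divfK// gt_eqF.
    by apply: ler_wpM2l; [exact/exprn_ge0/ltW | exact: ler_wiXn2l].
  rewrite (_ : _ - _ = (f (t0 + h) - (p J).[h]) + (p J - q).[h]); last first.
    by rewrite hornerD hornerN; ring.
  apply: le_trans (ler_normD _ _) _; apply: le_trans (lerD F2 E) _.
  by rewrite le_eqVlt; apply/orP; left; apply/eqP; ring.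
apply/cvgrPdist_le => e e0.
have cg : (fun J => 2 * M * (`|h| / r) ^+ J) @ \oo --> (0 : R).
  rewrite -(mulr0 (2 * M)); apply: cvgM; first exact: cvg_cst.
  by apply: cvg_expr; rewrite ger0_norm// ltr_pdivrMr// mul1r.
have /cvgrPdist_le/(_ e e0) := cg; apply: filterS => J.
rewrite sub0r normrN ger0_norm; last by rewrite !mulr_ge0 ?exprn_ge0.
exact: le_trans (bound J).
Qed.

Lemma real_analytic_germ n (c : R -> 'cV[R]_n) :
  real_analytic c <-> forall i t0, analytic_germ (fun t => c t i 0) t0.
Proof.
have coordE (a : nat -> 'cV[R]_n) (x : R) i N :
    series (fun j : nat => x ^+ j *: a j) N i 0 =
    series (fun j : nat => x ^+ j * a j i 0) N.
  by rewrite /series /= summxE; apply: eq_bigr => j _; rewrite mxE.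
split=> [H i t0|H t0].
  have [a ca] := H t0; apply: (@power_series_analytic (fun j => a j i 0)).
  apply: filterS ca => t /cvg_colP/(_ i).
  by under eq_fun do rewrite coordE.
have /boolp.choice[a ca] : forall i : 'I_n, exists a, \forall t \near t0,
    series (fun j : nat => (t - t0) ^+ j * a j) @ \oo --> c t i 0.
  by move=> i; exact: analytic_power_series.
exists (fun j => \col_i a i j).
have : \forall t \near t0, forall i : 'I_n,
    series (fun j : nat => (t - t0) ^+ j * a i j) @ \oo --> c t i 0.
  refine (@filter_forall _ _ (fun (i : 'I_n) t =>
    series (fun j : nat => (t - t0) ^+ j * a i j) @ \oo --> c t i 0) (nbhs t0) _ _) => i.
  exact: ca.
apply: filterS => t ct; apply/cvg_colP => i.
under eq_fun do rewrite coordE.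
by under eq_fun do under eq_fun do rewrite mxE; exact: ct.
Qed.

End PowerSeries.

(** * All smoothness classes at once *)

Section SmoothGerms.
Context {R : realType}.
Implicit Types (f g q y : R -> R) (t : R) (k : smoothness).

Definition smooth_at k f t : Prop :=
  match k with
  | Fin j => Cgerm j f t
  | Infty => forall j, Cgerm j f t
  | Omega => analytic_germ f t
  end.

(** Smoothness is asked at all points of one neighbourhood. For k = oo this makes
    a single neighbourhood serve all orders, and for k = omega it avoids
    expanding a power series again at nearby points. *)
Definition smooth_near k f t0 : Prop := \forall t \near t0, smooth_at k f t.

Lemma of_class_germ n k (c : R -> 'cV[R]_n) :
  of_class k c <-> forall i t, smooth_at k (fun t => c t i 0) t.
Proof.
case: k => [j||] /=.
- exact: class_Cn_germ.
- split=> [H i t0 j|H j]; first by have /class_Cn_germ := H j; exact.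
  by apply/class_Cn_germ => i t0; exact: H.
- exact: real_analytic_germ.
Qed.

Lemma smooth_cont k f t : smooth_at k f t -> {for t, continuous f}.
Proof.
case: k => [j||] /=; [exact: Cgerm_cont | by move=> /(_ 0%N)/Cgerm_cont |].
exact: analytic_cont.
Qed.

Lemma smooth_eq k f g t : (\near t, f t = g t) -> smooth_at k f t -> smooth_at k g t.
Proof.
case: k => [j||] /= fg; [exact: Cgerm_eq | | exact: analytic_eq].
by move=> H j; exact: Cgerm_eq (H j).
Qed.

Lemma smooth_cst k (a : R) t : smooth_at k (fun=> a) t.
Proof.
by case: k => [j||] /=; [exact: Cgerm_cst | move=> j; exact: Cgerm_cst | exact: analytic_cst].
Qed.

Lemma smooth_id k t : smooth_at k (fun t => t) t.
Proof.
by case: k => [j||] /=; [exact: Cgerm_id | move=> j; exact: Cgerm_id | exact: analytic_id].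
Qed.

Lemma smooth_D k f g t :
  smooth_at k f t -> smooth_at k g t -> smooth_at k (fun t => f t + g t) t.
Proof.
by case: k => [j||] /=; [exact: CgermD | move=> F G j; exact: CgermD | exact: analytic_D].
Qed.

Lemma smooth_M k f g t :
  smooth_at k f t -> smooth_at k g t -> smooth_at k (fun t => f t * g t) t.
Proof.
by case: k => [j||] /=; [exact: CgermM | move=> F G j; exact: CgermM | exact: analytic_M].
Qed.

Lemma smooth_V k f t : f t != 0 -> smooth_at k f t ->
  smooth_at k (fun t => (f t)^-1) t.
Proof.
by move=> f0; case: k => [j||] /=; [exact: CgermV | move=> F j; exact: CgermV | exact: analytic_V].
Qed.

Lemma smooth_comp k f g t :
  smooth_at k f (g t) -> smooth_at k g t -> smooth_at k (f \o g) t.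
Proof.
by case: k => [j||] /=; [exact: Cgerm_comp | move=> F G j; exact: Cgerm_comp | exact: analytic_comp].
Qed.

Lemma smooth_le k d e f t : (e <= d)%N ->
  smooth_at (add_smoothness k d) f t -> smooth_at (add_smoothness k e) f t.
Proof. by case: k => //= j ed; apply: (@Cgerm_le _ (j + d)); rewrite leq_add2l. Qed.

Lemma smooth_root k n (b : nat -> R -> R) y t0 :
  (forall i, (i < n)%N -> smooth_at k (b i) t0) ->
  (\forall t \near t0, derivable y t 1) ->
  (\forall t \near t0, \sum_(i < n) b i t * y t ^+ i = 0) ->
  \sum_(i < n) b i t0 * (i%:R * y t0 ^+ i.-1) != 0 ->
  smooth_at k y t0.
Proof.
case: k => [j||] /= cb dy root0 simple; first exact: (Cgerm_root cb dy root0 simple).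
  by move=> j; apply: (Cgerm_root _ dy root0 simple) => i ni; exact: cb.
have [C yC] : exists C : R, \forall x \near t0, `|y x - y t0| <= C * `|x - t0|.
  have /is_derive1_caratheodory[h [yh ch ht]] : is_derive t0 1 y ('D_1 y t0).
    exact/derivableP/(nbhs_singleton dy).
  exists (`|h t0| + 1).
  have /continuous_epsP/(_ 1 ltr01) := ch; apply: filterS => x hx.
  rewrite yh normrM; apply: ler_wpM2r => //.
  rewrite -[h x](subrK (h t0)); apply: le_trans (ler_normD _ _) _.
  by rewrite addrC lerD2l.
exact: (@analytic_root _ n b y t0 C).
Qed.

Lemma smooth_div k e b q t0 : smooth_at (add_smoothness k e.+1) b t0 ->
  {for t0, continuous q} ->
  (\forall t \near t0, b t = (t - t0) * q t) ->
  smooth_at (add_smoothness k e) q t0.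
Proof.
move=> + cq bq; case: k => [j||] /=.
- by rewrite addnS => /Cgerm_div; apply.
- by move=> H j; exact: Cgerm_div (H j.+1) cq bq.
- by move=> H; exact: analytic_div H cq bq.
Qed.

Lemma smooth_near_cont k f t0 : smooth_near k f t0 -> \forall t \near t0, {for t, continuous f}.
Proof. by apply: filterS => t; exact: smooth_cont. Qed.

Lemma smooth_near_eq k f g t0 : (\forall t \near t0, f t = g t) -> smooth_near k f t0 -> smooth_near k g t0.
Proof.
move=> /near_join fg; rewrite /smooth_near.
by apply: filter_app; apply: filterS fg => t; exact: smooth_eq.
Qed.

Lemma smooth_near_cst k (a : R) t0 : smooth_near k (fun=> a) t0.
Proof. by near=> t; exact: smooth_cst. Unshelve. all: by end_near. Qed.

Lemma smooth_near_D k f g t0 : smooth_near k f t0 -> smooth_near k g t0 -> smooth_near k (fun t => f t + g t) t0.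
Proof.
by move=> F; apply: filter_app; apply: filterS F => t; exact: smooth_D.
Qed.

Lemma smooth_near_M k f g t0 : smooth_near k f t0 -> smooth_near k g t0 -> smooth_near k (fun t => f t * g t) t0.
Proof.
by move=> F; apply: filter_app; apply: filterS F => t; exact: smooth_M.
Qed.

Lemma smooth_near_X k f n t0 : smooth_near k f t0 -> smooth_near k (fun t => f t ^+ n) t0.
Proof.
move=> cf; elim: n => [|n IH].
  by apply: (@smooth_near_eq _ (fun=> 1)); [near=> t; rewrite expr0 | exact: smooth_near_cst].
by apply: (@smooth_near_eq _ (fun t => f t * f t ^+ n)); [near=> t; rewrite exprS | exact: smooth_near_M].
Unshelve. all: by end_near. Qed.

Lemma smooth_near_sum k (I : Type) (s : seq I) (F : I -> R -> R) t0 :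
  (forall i, smooth_near k (F i) t0) -> smooth_near k (fun t => \sum_(i <- s) F i t) t0.
Proof.
move=> H; elim: s => [|i s IH].
  by apply: (@smooth_near_eq _ (fun=> 0)); [near=> t; rewrite big_nil | exact: smooth_near_cst].
apply: (@smooth_near_eq _ (fun t => F i t + \sum_(i <- s) F i t)); last exact: smooth_near_D.
by near=> t; rewrite big_cons.
Unshelve. all: by end_near. Qed.

Lemma smooth_near_prod k (I : Type) (s : seq I) (F : I -> R -> R) t0 :
  (forall i, smooth_near k (F i) t0) -> smooth_near k (fun t => \prod_(i <- s) F i t) t0.
Proof.
move=> H; elim: s => [|i s IH].
  by apply: (@smooth_near_eq _ (fun=> 1)); [near=> t; rewrite big_nil | exact: smooth_near_cst].
apply: (@smooth_near_eq _ (fun t => F i t * \prod_(i <- s) F i t)); last exact: smooth_near_M.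
by near=> t; rewrite big_cons.
Unshelve. all: by end_near. Qed.

Lemma smooth_near_meval k n (p : mpoly n R) (F : 'I_n -> R -> R) t0 :
  (forall i, smooth_near k (F i) t0) -> smooth_near k (fun t => meval (fun i => F i t) p) t0.
Proof.
move=> H; apply: (@smooth_near_eq _ (fun t => \sum_(m <- msupp p)
    mcoeff m p * \prod_(i <- index_enum 'I_n) F i t ^+ fun_of_multinom m i)).
  by near=> t; rewrite mevalE.
apply: smooth_near_sum => m; apply: smooth_near_M; first exact: smooth_near_cst.
by apply: smooth_near_prod => i; exact: smooth_near_X.
Unshelve. all: by end_near. Qed.

Lemma smooth_near_le k d e f t0 : (e <= d)%N ->
  smooth_near (add_smoothness k d) f t0 -> smooth_near (add_smoothness k e) f t0.
Proof. by move=> ed; apply: filterS => t; exact: smooth_le. Qed.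

Lemma smooth_near_root k n (b : nat -> R -> R) y t0 :
  (forall i, smooth_near k (b i) t0) ->
  (\forall t \near t0, derivable y t 1) ->
  (\forall t \near t0, \sum_(i < n) b i t * y t ^+ i = 0) ->
  \sum_(i < n) b i t0 * (i%:R * y t0 ^+ i.-1) != 0 ->
  smooth_near k y t0.
Proof.
move=> cb dy root0 simple.
pose P t := \sum_(i < n) b i t * (i%:R * y t ^+ i.-1).
have cP : {for t0, continuous P}.
  apply: (@Cgerm_cont _ 0).
  apply: (@Cgerm_sum _ _ _ (fun i t => b i t * (i%:R * y t ^+ i.-1))) => i ni.
  apply: CgermM; first exact: (smooth_near_cont (cb i)).
  apply: CgermM; first exact: Cgerm_cst.
  apply: CgermX; apply: filterS dy => t.
  by move=> /derivable1_diffP/differentiable_continuous.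
have nP := near_neq0 cP simple.
have ab : \forall t \near t0, forall i : 'I_n, smooth_at k (b i) t.
  refine (@filter_forall _ _ (fun (i : 'I_n) t => smooth_at k (b i) t) (nbhs t0) _ _) => i.
  exact: cb.
have root1 := near_join root0; have dy1 := near_join dy.
near=> t; apply: (@smooth_root _ n b); [|by near: t..].
have abt : forall i : 'I_n, smooth_at k (b i) t by near: t.
by move=> i ni; exact: (abt (Ordinal ni)).
Unshelve. all: by end_near. Qed.

(** Away from t0 the quotient is b times the inverse of t - t0, so only the point
    t0 itself calls for Hadamard division. *)
Lemma smooth_near_div k e b q t0 : smooth_near (add_smoothness k e.+1) b t0 ->
  (\forall t \near t0, {for t, continuous q}) ->
  (\forall t \near t0, b t = (t - t0) * q t) ->
  smooth_near (add_smoothness k e) q t0.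
Proof.
move=> ab cq bq; have bq1 := near_join bq.
near=> t; have abt : smooth_at (add_smoothness k e.+1) b t by near: t.
have [->|tt0] := eqVneq t t0.
  exact: smooth_div (nbhs_singleton ab) (nbhs_singleton cq) bq.
apply: (@smooth_eq _ (fun x => b x * (x - t0)^-1)).
  have : \forall x \near t, b x = (x - t0) * q x by near: t.
  apply: filter_app; apply: filterS (near_neq tt0) => x xt0 ->.
  by rewrite mulrAC divff ?mul1r// subr_eq0.
apply: smooth_M; first exact: smooth_le abt.
apply: smooth_V; first by rewrite subr_eq0.
by apply: smooth_D; [exact: smooth_id | exact: smooth_cst].
Unshelve. all: by end_near. Qed.

Lemma smooth_near_divX k e b q t0 : smooth_near (add_smoothness k e) b t0 ->
  (\forall t \near t0, {for t, continuous q}) ->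
  (\forall t \near t0, b t = (t - t0) ^+ e * q t) ->
  smooth_near k q t0.
Proof.
have k0 f : smooth_near (add_smoothness k 0) f t0 -> smooth_near k f t0.
  by case: k => //= j; rewrite addn0.
elim: e b => [|e IH] b cb cq bq.
  apply: (@smooth_near_eq _ b); last exact: k0.
  by apply: filterS bq => t ->; rewrite expr0 mul1r.
apply: (IH (fun t => (t - t0) ^+ e * q t)) => //; last by near=> t.
apply: (smooth_near_div cb).
  apply: filterS cq => t ct; apply: continuousM => //.
  apply: (@Cgerm_cont _ 0); apply: CgermX; apply: CgermD; first exact: Cgerm_id.
  exact: Cgerm_cst.
by apply: filterS bq => t ->; rewrite mulrA -exprS.
Unshelve. all: by end_near. Qed.

End SmoothGerms.

(** * Polynomial functions and their restrictions to lines *)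

Section PolynomialFunctions.
Context {R : realType} {m : nat}.
Implicit Types (p q : mpoly m R) (v x a : 'cV[R]_m).

Lemma poly_evalM p q v : poly_eval (p * q) v = poly_eval p v * poly_eval q v.
Proof. exact: rmorphM. Qed.

Lemma poly_evalD p q v : poly_eval (p + q) v = poly_eval p v + poly_eval q v.
Proof. exact: rmorphD. Qed.

Lemma poly_eval_prod (I : Type) (s : seq I) (P : pred I) (F : I -> mpoly m R) v :
  poly_eval (\prod_(i <- s | P i) F i) v = \prod_(i <- s | P i) poly_eval (F i) v.
Proof. exact: rmorph_prod. Qed.

Definition sqnorm v : R := \sum_i v i 0 ^+ 2.

Lemma sqnormE v : sqnorm v = (v^T *m v) 0 0.
Proof. by rewrite mxE; apply: eq_bigr => i _; rewrite mxE expr2. Qed.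

Lemma sqnorm_eq0 v : sqnorm v = 0 -> v = 0.
Proof.
move=> v0; apply/colP => i; rewrite mxE.
have /psumr_eq0P : sqnorm v = 0 by [].
move=> /(_ (fun i _ => sqr_ge0 _))/(_ i isT)/eqP.
by rewrite sqrf_eq0 => /eqP.
Qed.

Lemma sqnorm_ge0 v : 0 <= sqnorm v.
Proof. by apply: sumr_ge0 => i _; exact: sqr_ge0. Qed.

Lemma sqnorm_gt0 v : v != 0 -> 0 < sqnorm v.
Proof.
by move=> v0; rewrite lt_neqAle sqnorm_ge0 andbT eq_sym; apply: contraNneq v0 => /sqnorm_eq0 ->.
Qed.

Definition sqdist_poly a : mpoly m R :=
  \sum_i (mpolyX R (mnm1 i) - mpolyC m (a i 0)) ^+ 2.

Lemma sqdist_polyE a v : poly_eval (sqdist_poly a) v = sqnorm (v - a).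
Proof.
rewrite /poly_eval /sqdist_poly rmorph_sum; apply: eq_bigr => i _.
by rewrite rmorphXn rmorphB /= mevalXU mevalC !mxE.
Qed.

Definition lin_subst (A : 'M[R]_m) p : mpoly m R :=
  comp_mpoly [tuple \sum_j mpolyC m (A i j) * mpolyX R (mnm1 j) | i < m] p.

Lemma lin_substE A p v : poly_eval (lin_subst A p) v = poly_eval p (A *m v).
Proof.
rewrite /poly_eval /lin_subst comp_mpoly_meval; apply: meval_eq => i.
rewrite tnth_mktuple rmorph_sum mxE; apply: eq_bigr => j _.
by rewrite rmorphM /= mevalC mevalXU.
Qed.

Lemma poly_eval_continuous p : continuous (poly_eval p).
Proof.
move=> v.
have cX i e : {for v, continuous (fun v : 'cV[R]_m => v i 0 ^+ e)}.
  exact: (continuous_comp (@coord_continuous R m 1 i 0 v) (@exprn_continuous R e _)).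
have cP (l : seq 'I_m) M :
    {for v, continuous (fun v : 'cV[R]_m => \prod_(i <- l) v i 0 ^+ fun_of_multinom M i)}.
  elim: l => [|i l IH].
    rewrite (_ : (fun _ => _) = fun=> 1) => [|]; first exact: cst_continuous.
    by apply/funext => x; rewrite big_nil.
  rewrite (_ : (fun _ => _) = (fun v : 'cV[R]_m => v i 0 ^+ fun_of_multinom M i *
    \prod_(i <- l) v i 0 ^+ fun_of_multinom M i)) => [|].
    exact: continuousM (cX i _) IH.
  by apply/funext => x; rewrite big_cons.
rewrite (_ : poly_eval p = fun v => \sum_(M <- msupp p)
    mcoeff M p * \prod_(i <- index_enum 'I_m) v i 0 ^+ fun_of_multinom M i) => [|]; last first.
  by apply/funext => x; rewrite /poly_eval mevalE.
elim: (msupp p) => [|M s IH].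
  rewrite (_ : (fun _ => _) = fun=> 0) => [|]; first exact: cst_continuous.
  by apply/funext => x; rewrite big_nil.
rewrite (_ : (fun _ => _) = (fun v : 'cV[R]_m =>
    mcoeff M p * (\prod_(i <- index_enum 'I_m) v i 0 ^+ fun_of_multinom M i) +
    \sum_(M <- s) mcoeff M p * \prod_(i <- index_enum 'I_m) v i 0 ^+ fun_of_multinom M i))
    => [|].
  have cc : {for v, continuous (fun _ : 'cV[R]_m => mcoeff M p)} by exact: cst_continuous.
  exact: continuousD (continuousM cc (cP _ _)) IH.
by apply/funext => x; rewrite big_cons.
Qed.

Lemma horner_ext (p q : {poly R}) : (forall s, p.[s] = q.[s]) -> p = q.
Proof.
move=> pq; apply/eqP; rewrite -subr_eq0; apply/negPn/negP => d0.
have := max_poly_roots (rs := [seq i%:R | i <- iota 0 (size (p - q))]) d0.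
rewrite size_map size_iota ltnn => H; apply: notF; apply: H.
  by apply/allP => _ /mapP[i _ ->]; rewrite rootE !hornerE pq subrr.
rewrite map_inj_uniq ?iota_uniq// => i j /eqP; rewrite eqr_nat => /eqP //.
Qed.

(** The restriction of p to the line through v in direction x, as a polynomial in
    the parameter of the line. *)
Definition ray p v x : {poly R} :=
  mmap (@polyC R) (fun i => (v i 0)%:P + (x i 0)%:P * 'X) p.

Lemma horner_ray p v x s : (ray p v x).[s] = poly_eval p (v + s *: x).
Proof.
rewrite /ray /mmap horner_sum /poly_eval mevalE; apply: eq_bigr => M _.
rewrite hornerM hornerC /mmap1 horner_prod; congr (_ * _); apply: eq_bigr => i _.
by rewrite horner_exp !hornerE !mxE [s * _]mulrC.
Qed.

Lemma coef_ray_scale p v x s i : (ray p v (s *: x))`_i = s ^+ i * (ray p v x)`_i.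
Proof.
have -> : ray p v (s *: x) = \poly_(j < size (ray p v x)) (s ^+ j * (ray p v x)`_j).
  apply: horner_ext => u; rewrite horner_ray scalerA horner_poly.
  rewrite -horner_ray horner_coef; apply: eq_bigr => j _.
  by rewrite exprMn mulrCA mulrA [_ * s ^+ j]mulrC -!mulrA [_`_j * _]mulrC.
rewrite coef_poly; case: ltnP => // le.
by rewrite (nth_default _ le) mulr0.
Qed.

Lemma size_ray p v x : (size (ray p v x) <= mmeasure mdeg p)%N.
Proof.
rewrite /ray /mmap; apply: leq_trans (size_sum _ _ _) _.
apply/bigmax_leqP_seq => M Mp _; rewrite mul_polyC.
apply: leq_trans (size_scale_leq _ _) _.
apply: leq_trans (msize_mdeg_lt Mp).
rewrite /mmap1 mdegE.
elim/big_ind2: _ => [|a i b j ai bj|i _]; first by rewrite size_poly1.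
  apply: leq_trans (size_polyMleq _ _) _.
  by rewrite -subn1 leq_subLR add1n -addSn -addnS; apply: leq_add.
apply: leq_trans (size_poly_exp_leq _ _) _; rewrite ltnS.
set l := _ + _; have l2 : (size l <= 2)%N.
  apply: leq_trans (size_polyD _ _) _; rewrite geq_max.
  rewrite (leq_trans (size_polyC_leq1 _))//= mul_polyC.
  by apply: leq_trans (size_scale_leq _ _) _; rewrite size_polyX.
rewrite -[leqRHS]mul1n leq_mul2r; apply/orP; right.
by case: (size l) l2 => [|[|[]]].
Qed.

(** The coefficient of degree e of the ray through v in direction x - a, as a
    polynomial in x: the indeterminates enter the direction only. *)
Definition ray_coef p v a (e : nat) : mpoly m R :=
  (mmap (fun c => (mpolyC m c)%:P)
     (fun i => (mpolyC m (v i 0))%:P + (mpolyX R (mnm1 i) - mpolyC m (a i 0))%:P * 'X)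
     p)`_e.

Lemma ray_coefE p v a e x : poly_eval (ray_coef p v a e) x = (ray p v (x - a))`_e.
Proof.
rewrite /poly_eval /ray_coef -coef_map /=; congr (nth _ (polyseq _) _).
rewrite /mmap rmorph_sum; apply: eq_bigr => M _.
rewrite rmorphM /= map_polyC /= mevalC; congr (_ * _).
rewrite /mmap1 rmorph_prod; apply: eq_bigr => i _.
rewrite rmorphXn rmorphD rmorphM /= map_polyX !map_polyC /= mevalC rmorphB /=.
by rewrite mevalXU mevalC !mxE.
Qed.

End PolynomialFunctions.

(** * Invariants along a differentiable lift *)

Section Invariants.
Context {R : realType} {gT : finGroupType} {G : {group gT}} {m : nat}.
Variable rho : mx_representation R G m.
Implicit Types (p : mpoly m R) (v x y : 'cV[R]_m) (g h : gT).
Hypothesis orth : orthogonal_repr rho.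

Lemma sqnorm_act g v : g \in G -> sqnorm (rho g *m v) = sqnorm v.
Proof. by move=> gG; rewrite !sqnormE trmx_mul mulmxA -[_ *m _ *m rho g]mulmxA orth// mulmx1. Qed.

Lemma actM g h v : g \in G -> h \in G -> rho (g * h)%g *m v = rho g *m (rho h *m v).
Proof. by move=> gG hG; rewrite repr_mxM// mulmxA. Qed.

Lemma actVK g v : g \in G -> rho g^-1%g *m (rho g *m v) = v.
Proof. by move=> gG; rewrite -actM ?groupV// mulVg repr_mx1 mul1mx. Qed.

Lemma invariant_generated (s : seq (mpoly m R)) p :
  homogeneous_generators rho s -> invariant_poly rho p ->
  exists q : mpoly (size s) R,
    forall v, poly_eval p v = meval (fun i => poly_eval (tnth (in_tuple s) i) v) q.
Proof. by move=> [_ gen] /gen[q ->]; exists q => v; rewrite /poly_eval comp_mpoly_meval. Qed.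

(** The product over g of the squared distances to g x is an invariant polynomial,
    by orthogonality, and it vanishes exactly on the orbit of x. *)
Lemma orbit_separation n (sigma : n.-tuple (mpoly m R)) x y :
  homogeneous_generators rho sigma -> orbit_map sigma x = orbit_map sigma y ->
  exists2 g, g \in G & y = rho g *m x.
Proof.
move=> gen xy.
pose f := \prod_(g in G) sqdist_poly (rho g *m x).
have fE v : poly_eval f v = \prod_(g in G) sqnorm (v - rho g *m x).
  by rewrite poly_eval_prod; apply: eq_bigr => g _; rewrite sqdist_polyE.
have finv : invariant_poly rho f.
  move=> h v hG; rewrite !fE (reindex_inj (mulgI h)) /=.
  apply: eq_big => [g|g gG]; first by rewrite groupMl.
  by rewrite actM -?mulmxBr ?sqnorm_act// -(groupMl _ hG).
have [q fq] := invariant_generated gen finv.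
have : poly_eval f y = 0.
  have -> : poly_eval f y = poly_eval f x.
    rewrite !fq; apply: meval_eq => i.
    have /tnthP[j ->] : tnth (in_tuple sigma) i \in sigma by exact: mem_tnth.
    by move/colP/(_ j): xy; rewrite !mxE.
  rewrite fE (bigD1 1%g)//= repr_mx1 mul1mx subrr.
  by rewrite /sqnorm big1 ?mul0r// => i _; rewrite mxE expr0n.
rewrite fE => /eqP/prodf_eq0[g gG /eqP/sqnorm_eq0/eqP].
by rewrite subr_eq0 => /eqP ->; exists g.
Qed.

Lemma smooth_near_invariant n (sigma : n.-tuple (mpoly m R)) k c (u : R -> 'cV[R]_m) p t0 :
  homogeneous_generators rho sigma -> invariant_poly rho p ->
  (forall t, orbit_map sigma (u t) = c t) -> of_class k c ->
  smooth_near k (fun t => poly_eval p (u t)) t0.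
Proof.
move=> gen pinv uc /of_class_germ ck; have [q pq] := invariant_generated gen pinv.
apply: (@smooth_near_eq _ _ (fun t => meval (fun i => poly_eval (tnth (in_tuple sigma) i) (u t)) q)).
  by near=> t; rewrite pq.
apply: (@smooth_near_meval _ k _ q (fun i t => poly_eval (tnth (in_tuple sigma) i) (u t))) => i.
have /tnthP[j ->] : tnth (in_tuple sigma) i \in sigma by exact: mem_tnth.
near=> t; apply: smooth_eq (ck j t).
by near=> s; rewrite -uc mxE.
Unshelve. all: by end_near. Qed.

(** Each derivative lowers the multiplicity of the root a by one. This turns the
    repeated root caused by a stabiliser into a simple one. *)
Lemma derivn_multiple_root (a : R) (S : {poly R}) n :
  exists2 T : {poly R}, (('X - a%:P) ^+ n.+1 * S)^`(n) = ('X - a%:P) * T &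
    T.[a] = n.+1`!%:R * S.[a].
Proof.
elim: n S => [|n IH] S; first by exists S; rewrite ?expr1 // mul1r.
have [T TE Ta] := IH (S *+ n.+2 + ('X - a%:P) * S^`()).
have E : (('X - a%:P) ^+ n.+2 * S)^`() =
    ('X - a%:P) ^+ n.+1 * (S *+ n.+2 + ('X - a%:P) * S^`()).
  rewrite derivM deriv_exp derivXsubC mul1r succnK mulrDr mulrnAl mulrnAr.
  by rewrite mulrA -exprSr.
exists T; first by rewrite derivSn E TE.
rewrite Ta hornerD hornerM hornerXsubC subrr mul0r addr0 hornerMn.
by rewrite mulrnAr -mulrnAl -mulrnA mulnC -factS.
Qed.

Lemma horner_deriv_wide (r : {poly R}) n (a : R) : (size r <= n)%N ->
  r^`().[a] = \sum_(i < n) r`_i * (i%:R * a ^+ i.-1).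
Proof.
case: n => [|n] rn.
  by move: rn; rewrite leqn0 size_poly_eq0 => /eqP ->; rewrite deriv0 horner0 big_ord0.
rewrite big_ord_recl mul0r mulr0 add0r (@horner_coef_wide _ n).
  by apply: eq_bigr => i _; rewrite coef_deriv lift0 /= mulr_natl mulrnAl mulrnAr.
apply/leq_sizeP => j nj; rewrite coef_deriv nth_default ?mul0rn//.
exact: leq_trans rn _.
Qed.

Lemma derivable_poly_eval p (u : R -> 'cV[R]_m) t :
  derivable u t 1 -> derivable (fun t => poly_eval p (u t)) t 1.
Proof.
move=> /derivable_mxP du.
rewrite (_ : (fun _ => _) = fun t => \sum_(M <- msupp p)
    mcoeff M p * \prod_(i <- index_enum 'I_m) u t i 0 ^+ fun_of_multinom M i) => [|]; last first.
  by apply/funext => x; rewrite /poly_eval mevalE.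
have dX i e : derivable (fun t => u t i 0 ^+ e) t 1.
  elim: e => [|e IH]; first exact: derivable_cst.
  rewrite (_ : (fun _ => _) = (fun t => u t i 0) * (fun t => u t i 0 ^+ e)).
    exact: derivableM.
  by apply/funext => x; rewrite exprS.
elim: (msupp p) => [|M s IH].
  rewrite (_ : (fun _ => _) = cst 0); first exact: derivable_cst.
  by apply/funext => x; rewrite big_nil.
rewrite (_ : (fun _ => _) = (cst (mcoeff M p) *
    (fun t => \prod_(i <- index_enum 'I_m) u t i 0 ^+ fun_of_multinom M i)) +
    (fun t => \sum_(M <- s) mcoeff M p *
      \prod_(i <- index_enum 'I_m) u t i 0 ^+ fun_of_multinom M i)); last first.
  by apply/funext => x; rewrite big_cons.
apply: derivableD => //; apply: derivableM; first exact: derivable_cst.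
elim: (index_enum _) => [|i l IHl].
  rewrite (_ : (fun _ => _) = cst 1); first exact: derivable_cst.
  by apply/funext => x; rewrite big_nil.
rewrite (_ : (fun _ => _) = (fun t => u t i 0 ^+ fun_of_multinom M i) *
    (fun t => \prod_(i <- l) u t i 0 ^+ fun_of_multinom M i)).
  exact: derivableM.
by apply/funext => x; rewrite big_cons.
Qed.

Definition stab_invariant v0 p : Prop :=
  forall g v, g \in G -> rho g *m v0 = v0 -> poly_eval p (rho g *m v) = poly_eval p v.

(** Along the curve, p is a root of the product over g of X - p o g, whose
    coefficients are invariant and hence smooth. If N group elements fix u t0, the
    multiplicity of this root is at least N along the curve, and exactly N at t0
    by the separation hypothesis. So p is a root of the derivative of order N - 1,
    and a simple one at t0. *)
Lemma smooth_near_stab_separating k (u : R -> 'cV[R]_m) p t0 :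
  (forall q, invariant_poly rho q -> smooth_near k (fun t => poly_eval q (u t)) t0) ->
  (forall t, derivable u t 1) -> stab_invariant (u t0) p ->
  (forall g, g \in G -> rho g *m u t0 != u t0 ->
     poly_eval p (rho g *m u t0) != poly_eval p (u t0)) ->
  smooth_near k (fun t => poly_eval p (u t)) t0.
Proof.
move=> inv du pstab psep; set v0 := u t0 in pstab psep.
pose QQ : {poly (mpoly m R)} := \prod_(g in G) ('X - (lin_subst (rho g) p)%:P).
pose Q v : {poly R} := \prod_(g in G) ('X - (poly_eval p (rho g *m v))%:P).
have QE v i : poly_eval QQ`_i v = (Q v)`_i.
  rewrite /poly_eval -coef_map /=; congr (nth _ (polyseq _) _).
  rewrite rmorph_prod; apply: eq_bigr => g _.
  rewrite rmorphB /= map_polyX map_polyC /=; congr (_ - _%:P).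
  exact: lin_substE.
have Qinv h v : h \in G -> Q (rho h *m v) = Q v.
  move=> hG; rewrite [RHS](reindex_inj (mulIg h)) /=.
  apply: eq_big => [g|g gG]; first by rewrite groupMr.
  by rewrite actM// -(groupMr _ hG).
have QQinv i : invariant_poly rho QQ`_i.
  by move=> h v hG; rewrite !QE Qinv.
pose H := [set g in G | rho g *m v0 == v0].
have H1 : (0 < #|H|)%N.
  by apply/card_gt0P; exists 1%g; rewrite inE group1 repr_mx1 mul1mx eqxx.
pose S v := \prod_(g in G | g \notin H) ('X - (poly_eval p (rho g *m v))%:P).
have QS v : Q v = ('X - (poly_eval p v)%:P) ^+ #|H|.-1.+1 * S v.
  rewrite prednK// /Q (bigID (mem H)) /=; congr (_ * _).
  rewrite -prodr_const; apply: eq_big => [g|g].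
    by rewrite !inE; case: (g \in G).
  by rewrite inE => /andP[gG /andP[_ /eqP gv]]; rewrite pstab.
set N := #|H|.-1 in QS.
pose b i t := ((Q (u t))^`(N))`_i.
have szb t : (size ((Q (u t))^`(N))%R <= size QQ)%N.
  apply/leq_sizeP => j nj; rewrite coef_derivn -QE nth_default ?/poly_eval ?meval0 ?mul0rn//.
  exact: leq_trans nj (leq_addl _ _).
apply: (@smooth_near_root _ k (size QQ) b).
- move=> i; apply: (@smooth_near_eq _ _ (fun t => poly_eval QQ`_(N + i) (u t) * ((N + i) ^_ N)%:R)).
    by near=> t; rewrite /b coef_derivn QE mulr_natr.
  by apply: smooth_near_M; [exact: inv | exact: smooth_near_cst].
- by near=> t; exact: derivable_poly_eval.
- near=> t; rewrite -horner_coef_wide// QS.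
  have [T -> _] := derivn_multiple_root (poly_eval p (u t)) (S (u t)) N.
  by rewrite !hornerE subrr mul0r.
rewrite -horner_deriv_wide// QS.
have [T -> Ta] := derivn_multiple_root (poly_eval p (u t0)) (S (u t0)) N.
rewrite derivM derivXsubC !hornerE subrr mul0r addr0 Ta.
rewrite mulf_neq0 ?pnatr_eq0 -?lt0n ?fact_gt0// /S horner_prod.
apply/prodf_neq0 => g /andP[gG]; rewrite !inE gG /= => gv.
by rewrite !hornerE subr_eq0 eq_sym; exact: psep.
Unshelve. all: by end_near. Qed.

(** Locally at u t0 the quotient by the stabiliser is the quotient by G: this is
    the smooth form of that fact. The squared distance to u t0 separates u t0 from
    the rest of its orbit, and so does p after adding a large multiple of it. *)
Lemma smooth_near_stab_invariant k (u : R -> 'cV[R]_m) p t0 :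
  (forall q, invariant_poly rho q -> smooth_near k (fun t => poly_eval q (u t)) t0) ->
  (forall t, derivable u t 1) -> stab_invariant (u t0) p ->
  smooth_near k (fun t => poly_eval p (u t)) t0.
Proof.
move=> inv du pstab; set v0 := u t0 in pstab *.
pose D := sqdist_poly v0.
have Dstab : stab_invariant v0 D.
  move=> g v gG gv; rewrite !sqdist_polyE -{1}gv -mulmxBr.
  exact: sqnorm_act.
have D0 g : rho g *m v0 != v0 -> 0 < poly_eval D (rho g *m v0).
  by move=> gv; rewrite sqdist_polyE sqnorm_gt0// subr_eq0.
have Dv0 : poly_eval D v0 = 0.
  by rewrite sqdist_polyE subrr /sqnorm big1// => i _; rewrite mxE expr0n.
have cD : smooth_near k (fun t => poly_eval D (u t)) t0.
  apply: smooth_near_stab_separating => // g gG gv.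
  by rewrite Dv0 gt_eqF// D0.
(* large enough for p + alpha D to separate v0 from the rest of its orbit *)
pose dev g := `|poly_eval p v0 - poly_eval p (rho g *m v0)| / poly_eval D (rho g *m v0).
have dev0 g : 0 <= dev g.
  by rewrite divr_ge0// sqdist_polyE sqnorm_ge0.
pose alpha := 1 + \sum_(g in G) dev g.
have alphaE v : poly_eval (p + mpolyC m alpha * D) v = poly_eval p v + alpha * poly_eval D v.
  by rewrite poly_evalD poly_evalM [poly_eval (mpolyC _ _) _]mevalC.
apply: (@smooth_near_eq _ _ (fun t => poly_eval (p + mpolyC m alpha * D) (u t) +
    (- alpha) * poly_eval D (u t))).
  by near=> t; rewrite alphaE mulNr addrK.
apply: smooth_near_D; last by apply: smooth_near_M => //; exact: smooth_near_cst.
apply: smooth_near_stab_separating => // [g v gG gv|g gG gv].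
  by rewrite !alphaE pstab// Dstab.
rewrite !alphaE -/v0 Dv0 mulr0 addr0; apply/eqP => E.
have Dg := D0 g gv.
have : alpha <= dev g.
  rewrite /dev ler_pdivlMr// -/v0 -E addrAC subrr add0r.
  exact: ler_norm.
apply/negP; rewrite -ltNge /alpha (bigD1 g)//=.
have : 0 <= \sum_(i in G | i != g) dev i by exact: sumr_ge0.
lra.
Unshelve. all: by end_near. Qed.

Lemma stab_invariant_ray_coef v0 w p e :
  invariant_poly rho p ->
  (forall g, g \in G -> rho g *m v0 = v0 -> rho g *m w = w) ->
  stab_invariant v0 (ray_coef p w v0 e).
Proof.
move=> pinv stab g v gG gv; rewrite !ray_coefE; congr (nth _ (polyseq _) _).
apply: horner_ext => s; rewrite !horner_ray -{1}gv -mulmxBr -{1}(stab _ gG gv).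
by rewrite scalemxAr -mulmxDr pinv.
Qed.

Lemma minimal_generators_exist (s : seq (mpoly m R)) :
  homogeneous_generators rho s -> exists s', minimal_generators rho s'.
Proof.
elim: {s}_.+1 {-2}s (ltnSn (size s)) => // N IH s sN gen.
have [[s' [ss' gen' ne]]|no] := pselect (exists s',
    [/\ subseq s' s, homogeneous_generators rho s' & s' <> s]); last first.
  exists s; split => // s' ss' gen'; apply: contrapT => ne; apply: no.
  by exists s'.
apply: IH gen'; rewrite -ltnS; apply: leq_trans sN; rewrite ltnS.
have [le eqs] := size_subseq_leqif ss'.
by rewrite ltn_neqAle le andbT eqs; apply/eqP.
Qed.

Lemma generators_of_bounded_degree (s : seq (mpoly m R)) :
  homogeneous_generators rho s ->
  exists2 s' : seq (mpoly m R), homogeneous_generators rho s' &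
    forall p, p \in s' -> (mmeasure mdeg p <= (max_degree rho).+1)%N.
Proof.
move=> /minimal_generators_exist[s0 min0].
have [s' [gen' _] dE] : [set d | exists2 s, minimal_generators rho s &
    d = \max_(p <- s) poly_degree p]%N (max_degree rho).
  by apply: xgetPex; exists (\max_(p <- s0) poly_degree p)%N; exists s0.
exists s' => // p ps; apply: leq_trans (leqSpred _) _; rewrite ltnS dE.
by rewrite (big_rem p ps) /= leq_max leqnn.
Qed.

End Invariants.

(** * Intermediate values of derivatives *)

Section Darboux.
Context {R : realType}.
Implicit Types (f psi : R -> R) (a b : R).

Lemma is_derive_near_neq0 (h : R -> R) t (l : R) : is_derive t (1 : R) h l -> l != 0 ->
  \forall x \near t, x != t -> h x != 0.
Proof.
move=> dh l0; have [ht0|ht0] := eqVneq (h t) 0; last first.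
  by apply: filterS (near_neq0 (is_derive_continuous dh) ht0) => x.
have /is_derive1_caratheodory[u [hu cu ut]] := dh.
have ut0 : u t != 0 by rewrite ut.
apply: filterS (near_neq0 cu ut0) => x ux xt.
by have := hu x; rewrite ht0 subr0 => ->; rewrite mulf_neq0// subr_eq0.
Qed.

Lemma is_derive_lt0_right (h : R -> R) a (l : R) b : a < b ->
  is_derive a (1 : R) h l -> l < 0 -> exists2 x, a < x < b & h x < h a.
Proof.
move=> ab /is_derive1_caratheodory[u [hu cu ua]] l0.
have /near_ball[d d0 Hd] : \forall x \near a, u x < 0.
  by apply: (cvgr_lt _ cu); rewrite ua.
pose x := a + Num.min (d / 2) ((b - a) / 2).
have m0 : 0 < Num.min (d / 2) ((b - a) / 2).
  by rewrite lt_min !divr_gt0// subr_gt0.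
have m1 : Num.min (d / 2) ((b - a) / 2) <= d / 2 by rewrite ge_min lexx.
have m2 : Num.min (d / 2) ((b - a) / 2) <= (b - a) / 2 by rewrite ge_min lexx orbT.
exists x; first by rewrite /x; lra.
rewrite -subr_lt0 hu pmulr_llt0; last by rewrite /x; lra.
by apply: Hd; rewrite /x addrAC subrr add0r gtr0_norm//; lra.
Qed.

Lemma is_derive_gt0_left (h : R -> R) b (l : R) a : a < b ->
  is_derive b (1 : R) h l -> 0 < l -> exists2 x, a < x < b & h x < h b.
Proof.
move=> ab /is_derive1_caratheodory[u [hu cu ub]] l0.
have /near_ball[d d0 Hd] : \forall x \near b, 0 < u x.
  by apply: (cvgr_gt _ cu); rewrite ub.
pose x := b - Num.min (d / 2) ((b - a) / 2).
have m0 : 0 < Num.min (d / 2) ((b - a) / 2).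
  by rewrite lt_min !divr_gt0// subr_gt0.
have m1 : Num.min (d / 2) ((b - a) / 2) <= d / 2 by rewrite ge_min lexx.
have m2 : Num.min (d / 2) ((b - a) / 2) <= (b - a) / 2 by rewrite ge_min lexx orbT.
exists x; first by rewrite /x; lra.
rewrite -subr_lt0 hu pmulr_rlt0; first by rewrite /x; lra.
by apply: Hd; rewrite /x addrAC subrr add0r normrN gtr0_norm//; lra.
Qed.

(** The minimum of f - lam * id on the closed interval lies in its interior. *)
Lemma darboux_up f psi a b (lam : R) : a < b ->
  (forall t, is_derive t (1 : R) f (psi t)) -> psi a < lam -> lam < psi b ->
  exists2 x, a < x < b & psi x = lam.
Proof.
move=> ab df al lb.
pose h x := f x - lam * x.
have dh t : is_derive t (1 : R) h (psi t - lam).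
  have dit : is_derive t (1 : R) (fun x : R => x) 1 by exact: is_derive_id.
  by have := is_deriveB_pt (df t) (is_deriveMl_pt lam dit); rewrite mulr1.
have ch : {within `[a, b], continuous h}.
  by apply: continuous_in_subspaceT => x _; exact: is_derive_continuous (dh x).
have [x xab xmin] := EVT_min (ltW ab) ch.
have inab y : a < y < b -> y \in `[a, b].
  by move=> /andP[ay yb]; rewrite in_itv /= !ltW.
have xa : x != a.
  apply/eqP => xa; have al0 : psi a - lam < 0 by rewrite subr_lt0.
  have [y yab] := is_derive_lt0_right ab (dh a) al0.
  by rewrite ltNge -xa xmin// inab.
have xb : x != b.
  apply/eqP => xb; have bl0 : 0 < psi b - lam by rewrite subr_gt0.
  have [y yab] := is_derive_gt0_left ab (dh b) bl0.
  by rewrite ltNge -xb xmin// inab.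
have xoo : a < x < b.
  by move: xab; rewrite in_itv /= => /andP[ax xlb]; rewrite !lt_neqAle ax xlb xb eq_sym xa.
exists x => //.
have dh1 : forall t, t \in `]a, b[%R -> derivable h t 1.
  by move=> t _; have [] := dh t.
have xin : x \in `]a, b[%R by rewrite in_itv.
have [_] := @derive1_at_min R h a b x (ltW ab) dh1 xin (fun t tab =>
  xmin t (inab t tab)).
have [_ ->] := dh x => /eqP; rewrite subr_eq0 => /eqP //.
Qed.

Lemma darboux_between f psi a b (lam : R) :
  (forall t, is_derive t (1 : R) f (psi t)) -> psi a < lam -> lam < psi b ->
  exists2 x, `|x - a| < `|b - a| & psi x = lam.
Proof.
move=> df al lb; have [ab|ba|ab] := ltgtP a b; last first.
- by move: al; rewrite ab => /lt_trans/(_ lb); rewrite ltxx.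
- have dN t : is_derive t (1 : R) (fun x => - f x) (- psi t) by exact: is_deriveN.
  have [x /andP[bx xa] /oppr_inj <-] : exists2 x, b < x < a & - psi x = - lam.
    by apply: (darboux_up ba dN); rewrite ltrN2.
  by exists x => //; rewrite !ltr0_norm ?subr_lt0//; lra.
- have [x /andP[ax xb] <-] := darboux_up ab df al lb.
  by exists x => //; rewrite !gtr0_norm ?subr_gt0//; lra.
Qed.

Lemma avoid_finite (l : seq R) a b : a < b -> exists2 lam, a < lam < b & lam \notin l.
Proof.
elim: l b => [|x l IH] b ab.
  by exists ((a + b) / 2) => //; lra.
have [lam lab ll] := IH b ab.
have [lx|lx] := eqVneq lam x; last by exists lam; rewrite // inE negb_or lx.
have /andP[ax xb] := lab.
have [mu /andP[am ml] mul] := IH lam ax.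
exists mu; first by rewrite am (lt_trans ml).
by rewrite inE negb_or mul andbT -lx lt_eqF.
Qed.

(** Values outside l can be found arbitrarily close above and below psi t0. Near
    t0 they are avoided, so by the intermediate value property of derivatives
    psi stays between them. *)
Lemma derivative_continuous_at f psi t0 (l : seq R) :
  (forall t, is_derive t (1 : R) f (psi t)) ->
  (forall lam, lam \notin l -> \forall t \near t0, psi t != lam) ->
  {for t0, continuous psi}.
Proof.
move=> df avoid; apply/continuous_epsP => e e0.
have [up /andP[up1 up2] upl] : exists2 lam, psi t0 < lam < psi t0 + e & lam \notin l.
  by apply: avoid_finite; rewrite ltrDl.
have [dn /andP[dn1 dn2] dnl] : exists2 lam, psi t0 - e < lam < psi t0 & lam \notin l.
  by apply: avoid_finite; rewrite ltrBlDr ltrDl.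
have /near_ball[d d0 Hd] : \forall t \near t0, psi t != up /\ psi t != dn.
  by apply: filterI; exact: avoid.
apply: (ball_near d0) => t td; rewrite ler_norml; apply/andP; split.
  rewrite lerBrDl; apply: le_trans (ltW dn1) _; rewrite leNgt; apply/negP => tdn.
  have dN x : is_derive x (1 : R) (fun x => - f x) (- psi x) by exact: is_deriveN.
  have [x xt /oppr_inj E] : exists2 x, `|x - t0| < `|t - t0| & - psi x = - dn.
    by apply: (darboux_between dN); rewrite ltrN2.
  by have [_] := Hd x (lt_trans xt td); rewrite E eqxx.
rewrite lerBlDl; apply: le_trans (ltW up2); rewrite leNgt; apply/negP => tup.
have [x xt E] := darboux_between df up1 tup.
by have [+ _] := Hd x (lt_trans xt td); rewrite E eqxx.
Qed.

End Darboux.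

(** * Squeezing the line into a small interval *)

Section Reparametrisation.
Context {R : realType}.
Variables (t0 eps : R).
Hypothesis eps0 : 0 < eps.

(** An analytic map of the whole line into the interval of radius eps around t0,
    with derivative eps at 0. The lifting property concerns curves on the whole
    line, and analytic curves admit no cut-off functions. *)
Definition squeeze s : R := t0 + eps * (s * (1 + s ^+ 2)^-1).

Definition dsqueeze s : R :=
  eps * (s * (- (1 + s ^+ 2) ^- 2 * (2 * s)) + (1 + s ^+ 2)^-1).

Lemma sq1_gt0 (s : R) : 0 < 1 + s ^+ 2.
Proof. by rewrite ltr_pwDl// sqr_ge0. Qed.

Lemma sq1_neq0 (s : R) : 1 + s ^+ 2 != 0.
Proof. by rewrite gt_eqF// sq1_gt0. Qed.

Lemma squeeze0 : squeeze 0 = t0.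
Proof. by rewrite /squeeze mul0r mulr0 addr0. Qed.

Lemma dsqueeze0 : dsqueeze 0 = eps.
Proof. by rewrite /dsqueeze mul0r add0r expr0n addr0 invr1 mulr1. Qed.

Lemma squeeze_lt s : `|squeeze s - t0| < eps.
Proof.
rewrite /squeeze addrAC subrr add0r normrM gtr0_norm// gtr_pMr//.
rewrite normrM normfV [`|1 + _|]gtr0_norm ?sq1_gt0// ltr_pdivrMr ?sq1_gt0// mul1r.
rewrite -[s ^+ 2]real_normK ?num_real//; have := normr_ge0 s; nra.
Qed.

Lemma squeeze_lip s : `|squeeze s - t0| <= eps * `|s|.
Proof.
rewrite /squeeze addrAC subrr add0r normrM gtr0_norm// ler_pM2l//.
rewrite normrM normfV [`|1 + _|]gtr0_norm ?sq1_gt0// ler_pdivrMr ?sq1_gt0//.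
by rewrite ler_peMr// lerDl sqr_ge0.
Qed.

Lemma smooth_squeeze k s : smooth_at k squeeze s.
Proof.
apply: smooth_D; first exact: smooth_cst.
apply: smooth_M; first exact: smooth_cst.
apply: smooth_M; first exact: smooth_id.
apply: (@smooth_V _ k (fun s => 1 + s ^+ 2)); first exact: sq1_neq0.
apply: smooth_D; first exact: smooth_cst.
apply: (@smooth_M _ k (fun s => s) (fun s => s)); exact: smooth_id.
Qed.

Lemma squeeze_continuous : continuous squeeze.
Proof. by move=> s; exact: (smooth_cont (smooth_squeeze (Fin 0) s)). Qed.

Lemma is_derive_squeeze s : is_derive s (1 : R) squeeze (dsqueeze s).
Proof.
have dit : is_derive s (1 : R) (fun x : R => x) 1 by exact: is_derive_id.
have d2 : is_derive s (1 : R) (fun x : R => 1 + x ^+ 2) (2 * s).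
  have := is_deriveD_pt (is_derive_cst (1 : R) s (1 : R)) (is_deriveX_pt 2 dit).
  by rewrite add0r mulr1.
have dV := @is_deriveV R (fun x => 1 + x ^+ 2) s _ 1 (sq1_neq0 s) d2.
have := is_deriveD_pt (is_derive_cst t0 s (1 : R))
  (is_deriveMl_pt eps (is_deriveM_pt dit dV)).
by rewrite add0r mulr1.
Qed.

Lemma dsqueeze_continuous : {for 0, continuous dsqueeze}.
Proof.
apply: (@Cgerm_cont _ 0); apply: CgermM; first exact: Cgerm_cst.
have c2 : Cgerm 0 (fun s : R => 1 + s ^+ 2) 0.
  by apply: CgermD; [exact: Cgerm_cst | apply: CgermX; exact: Cgerm_id].
have n2 := sq1_neq0 0.
apply: CgermD; last exact: CgermV.
apply: CgermM; first exact: Cgerm_id.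
apply: CgermM; last by apply: CgermM; [exact: Cgerm_cst | exact: Cgerm_id].
apply: CgermN; apply: (@CgermV _ 0 (fun s : R => (1 + s ^+ 2) ^+ 2)).
  by rewrite expf_neq0.
exact: CgermX.
Qed.

(** By the intermediate value theorem, squeeze maps neighbourhoods of 0 onto
    neighbourhoods of t0. *)
Lemma near_squeeze (P : R -> Prop) :
  (\forall s \near 0, P (squeeze s)) -> \forall t \near t0, P t.
Proof.
move=> /near_ball[d d0 Hd]; pose e := d / 2; have e0 : 0 < e by rewrite divr_gt0.
pose r := eps * (e * (1 + e ^+ 2)^-1).
have r0 : 0 < r by rewrite !mulr_gt0// invr_gt0 sq1_gt0.
apply: (ball_near r0) => t; rewrite ltr_norml => /andP[tr1 tr2].
have ere : squeeze (- e) <= squeeze e.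
  by rewrite /squeeze sqrrN mulNr mulrN -/r lerD2l; lra.
have [s] : exists2 s, s \in `[- e, e] & squeeze s = t.
  apply: IVT; first lra.
    exact: continuous_subspaceT squeeze_continuous.
  rewrite min_l// max_r//; rewrite /squeeze sqrrN mulNr mulrN -/r; lra.
rewrite in_itv /= => /andP[es se] <-; apply: Hd.
rewrite subr0 ltr_norml; rewrite /e in es se e0 *; lra.
Qed.

End Reparametrisation.

(** * Curves that agree up to a finite group *)

Section Lifts.
Context {R : realType} {gT : finGroupType} {G : {group gT}} {m : nat}.
Variable rho : mx_representation R G m.
Implicit Types (p : mpoly m R) (v x y : 'cV[R]_m) (g h : gT).

Lemma is_derive_mulmx_coord (A : 'M[R]_m) (u : R -> 'cV[R]_m) t i :
  derivable u t 1 ->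
  is_derive t (1 : R) (fun t => (A *m u t) i 0) ((A *m derive1 u t) i 0).
Proof.
move=> du; rewrite (_ : (fun _ => _) = \sum_j (fun t => A i j * u t j 0)); last first.
  by apply/funext => x; rewrite mxE fct_sumE.
rewrite mxE; apply: is_derive_sum => j.
exact/is_deriveMl_pt/is_derive_coord.
Qed.

Lemma continuous_mulmx_coord (A : 'M[R]_m) (u : R -> 'cV[R]_m) t i :
  (forall j, {for t, continuous (fun s => u s j 0)}) ->
  {for t, continuous (fun s => (A *m u s) i 0)}.
Proof.
move=> cu; pose F (s : R) := \sum_(j < m) A i j * u s j 0.
rewrite (_ : (fun _ => _) = F); last by apply/funext => s; rewrite mxE.
rewrite /F; elim: (index_enum _) => [|j l IH].
  rewrite (_ : (fun _ => _) = fun=> 0) => [|]; first exact: cst_continuous.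
  by apply/funext => s; rewrite big_nil.
rewrite (_ : (fun _ => _) = (fun s => A i j * u s j 0 +
    \sum_(j <- l) A i j * u s j 0)) => [|].
  have cc : {for t, continuous (fun _ : R => A i j)} by exact: cst_continuous.
  exact: continuousD (continuousM cc (cu j)) IH.
by apply/funext => s; rewrite big_cons.
Qed.

(** If the derivatives of u and g w differ at t, then u and g w differ at all nearby
    points other than t. As G is finite, this cannot happen for all g at once. *)
Lemma derive_in_orbit (u w : R -> 'cV[R]_m) t :
  derivable u t 1 -> derivable w t 1 ->
  (\forall s \near t, exists2 g, g \in G & u s = rho g *m w s) ->
  exists2 g, g \in G & derive1 u t = rho g *m derive1 w t.
Proof.
move=> du dw uw; apply: contrapT => no.
have sep g : g \in G -> \forall s \near t, s != t -> u s != rho g *m w s.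
  move=> gG; have [i ui] : exists i, derive1 u t i 0 != (rho g *m derive1 w t) i 0.
    apply: contrapT => H; apply: no; exists g => //; apply/colP => i.
    by apply: contrapT => /eqP ui; apply: H; exists i.
  have := is_deriveB_pt (is_derive_coord i du) (is_derive_mulmx_coord (rho g) i dw).
  move=> /is_derive_near_neq0; rewrite subr_eq0 => /(_ ui).
  apply: filterS => s us st; apply: contraNneq (us st) => ->.
  by rewrite subrr.
have sepall : \forall s \near t, forall g, g \in G -> s != t -> u s != rho g *m w s.
  refine (@filter_forall _ _ (fun g s => g \in G -> s != t -> u s != rho g *m w s)
    (nbhs t) _ _) => g.
  have [gG|gG] := boolP (g \in G); last by near=> s.
  by apply: filterS (sep g gG) => s H _.
have /near_ball[d d0 Hd] : \forall s \near t,
    (exists2 g, g \in G & u s = rho g *m w s) /\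
    (forall g, g \in G -> s != t -> u s != rho g *m w s) by exact: filterI.
have /Hd[[g gG ug] /(_ g gG)] : `|t + d / 2 - t| < d.
  by rewrite addrAC subrr add0r gtr0_norm ?divr_gt0//; lra.
rewrite ug eqxx => /(_ _)/negP; apply => //.
by rewrite -subr_eq0 addrAC subrr add0r gt_eqF// divr_gt0.
Unshelve. all: by end_near. Qed.

Lemma derive_comp_coord (u : R -> 'cV[R]_m) (f : R -> R) s (l : R) :
  derivable u (f s) 1 -> is_derive s (1 : R) f l ->
  derivable (u \o f) s 1 /\ derive1 (u \o f) s = l *: derive1 u (f s).
Proof.
move=> du df.
have dui i := @is_derive1_comp R (fun t => u t i 0) f s _ _ (is_derive_coord i du) df.
have duf : derivable (u \o f) s 1.
  by apply/derivable_mxP => i j; rewrite ord1; have [] := dui i.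
split=> //; apply/colP => i; rewrite mxE.
have [_ <-] := is_derive_coord i duf.
by have [_ ->] := dui i; rewrite mulrC.
Qed.

(** Up to the nonzero factor dsqueeze, the derivative of u at squeeze s is one of
    the finitely many g * derive1 ct s, each continuous at s = 0. Hence near t0 the
    derivative of u avoids all but finitely many values, which for a derivative
    implies continuity. *)
Lemma derive_continuous_of_orbit (u ct : R -> 'cV[R]_m) (t0 eps : R) i : 0 < eps ->
  (forall t, derivable u t 1) ->
  (\forall s \near 0, exists2 g, g \in G & u (squeeze t0 eps s) = rho g *m ct s) ->
  (\forall s \near 0, derivable ct s 1) ->
  (forall j, {for 0, continuous (fun s => derive1 ct s j 0)}) ->
  {for t0, continuous (fun t => derive1 u t i 0)}.
Proof.
move=> eps0 du uct dct cct.
pose phi := squeeze t0 eps; pose dphi := dsqueeze eps.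
pose X g s := (rho g *m derive1 ct s) i 0 / dphi s.
have dphi0 : dphi 0 != 0 by rewrite /dphi dsqueeze0 gt_eqF.
have cdphi : {for 0, continuous dphi} by exact: dsqueeze_continuous.
have nphi := near_neq0 cdphi dphi0.
have cX g : {for 0, continuous (X g)}.
  by apply: continuousM; [exact: continuous_mulmx_coord | exact: continuousV].
apply: (@derivative_continuous_at R (fun t => u t i 0) _ t0 [seq X g 0 | g : gT]).
  by move=> t; exact: is_derive_coord.
move=> lam laml.
have Xlam : \forall s \near 0, forall g, X g s != lam.
  refine (@filter_forall _ _ (fun g (s : R) => X g s != lam) (nbhs 0) _ _) => g.
  have cXl : {for 0, continuous (fun s => X g s - lam)}.
    by apply: continuousB => //; exact: cst_continuous.
  have X0 : X g 0 - lam != 0.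
    rewrite subr_eq0; apply: contraNneq laml => <-.
    by apply: map_f; rewrite mem_enum.
  by apply: filterS (near_neq0 cXl X0) => s; rewrite subr_eq0.
apply: (near_squeeze eps0); have uct1 := near_join uct.
near=> s.
have [duphi Eu] := derive_comp_coord (du (phi s)) (is_derive_squeeze t0 eps s).
have dcts : derivable ct s 1 by near: s.
have ucts : \forall s' \near s, exists2 g, g \in G & (u \o phi) s' = rho g *m ct s'.
  by near: s.
have [g gG] := derive_in_orbit duphi dcts ucts.
rewrite Eu => /colP/(_ i); rewrite [X in X = _]mxE => E.
have ds0 : dphi s != 0 by near: s.
have -> : derive1 u (squeeze t0 eps s) i 0 = X g s.
  by rewrite /X -E mulrAC divff// mul1r.
by move: g {gG E}; near: s.
Unshelve. all: by end_near. Qed.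

End Lifts.

(** * A local lift whose derivative is continuous *)

Section LocalLift.
Context {R : realType} {gT : finGroupType} {G : {group gT}} {m : nat}.
Variable rho : mx_representation R G m.
Implicit Types (p : mpoly m R) (v x y : 'cV[R]_m) (g h : gT).
Hypothesis orth : orthogonal_repr rho.

Lemma orbit_map0 n (sigma : n.-tuple (mpoly m R)) :
  homogeneous_generators rho sigma -> orbit_map sigma 0 = 0.
Proof.
move=> [gen _]; apply/colP => i; rewrite !mxE.
have [_ ] := gen _ (mem_tnth i sigma); move: (tnth _ _) => p.
rewrite homog_msize => /dhomog_mf hp dp.
rewrite /poly_eval mevalE big1_seq// => M /andP[_ Mp].
have dM : mdeg M = poly_degree p := hp M Mp.
have [j Mj] : exists j, (0 < fun_of_multinom M j)%N.
  apply: contrapT => no; move: dp; rewrite -dM mdegE big1// => j _.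
  by apply/eqP; rewrite -leqn0 leqNgt; apply/negP => Mj; apply: no; exists j.
by rewrite (bigD1 j)//= mxE expr0n gtn_eqF// mul0r mulr0.
Qed.

Lemma difference_quotient (u : R -> 'cV[R]_m) t0 : (forall t, derivable u t 1) ->
  exists w : R -> 'cV[R]_m,
    (forall t, u t = u t0 + (t - t0) *: w t) /\
    (forall t i, {for t, continuous (fun t => w t i 0)}).
Proof.
move=> du.
have /boolp.choice[h Hh] : forall i, exists h : R -> R,
    (forall t, u t i 0 - u t0 i 0 = h t * (t - t0)) /\ {for t0, continuous h}.
  move=> i; have /is_derive1_caratheodory[h [E ch _]] := is_derive_coord i (du t0).
  by exists h.
exists (fun t => \col_i h i t); split=> [t|t i].
  by apply/colP => i; rewrite !mxE mulrC -(Hh i).1 addrC subrK.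
have [E ch] := Hh i.
apply: (@near_eq_continuous _ (h i)); first by near=> s; rewrite mxE.
have [->//|tt0] := eqVneq t t0.
have cs : {for t, continuous (fun s : R => s - t0)}.
  exact: is_derive_continuous (is_derive_subc t0 t).
apply: (@near_eq_continuous _ (fun s => (u s i 0 - u t0 i 0) / (s - t0))).
  apply: filterS (near_neq tt0) => s st0.
  by rewrite E mulfK// subr_eq0.
apply: continuousM.
  apply: continuousB; last exact: cst_continuous.
  exact: is_derive_continuous (is_derive_coord i (du t)).
by apply: continuousV => //; rewrite subr_eq0.
Unshelve. all: by end_near. Qed.

(** The invariant p is a polynomial in minimal generators f, of degree at most
    d = max_degree rho. Expand f (v + nu * w) in powers of nu: since u t - u t0 is
    (t - t0) * w t, the coefficient of degree e is the value at u of a polynomial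
    invariant under the stabiliser of u t0, divided by (t - t0)^e. The former is
    smooth of class k + d and e is at most d, so division leaves class k. *)
Lemma smooth_near_quotient n (sigma : n.-tuple (mpoly m R)) k c (u w : R -> 'cV[R]_m) t0 v nu p :
  homogeneous_generators rho sigma ->
  (forall t, orbit_map sigma (u t) = c t) ->
  of_class (add_smoothness k (max_degree rho)) c ->
  (forall t, derivable u t 1) ->
  (forall t, u t = u t0 + (t - t0) *: w t) ->
  (forall t i, {for t, continuous (fun t => w t i 0)}) ->
  (forall g, g \in G -> rho g *m u t0 = u t0 -> rho g *m v = v) ->
  invariant_poly rho p ->
  smooth_near k (fun t => poly_eval p (v + nu *: w t)) t0.
Proof.
move=> gen uc cK du uw cw stab pinv.
have [s gen' degs] := generators_of_bounded_degree gen.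
have [q pq] := invariant_generated gen' pinv.
have cwv t : {for t, continuous w}.
  apply/cvg_colP => i; exact: cw.
apply: (@smooth_near_eq _ _ (fun t => meval (fun i => poly_eval (tnth (in_tuple s) i)
    (v + nu *: w t)) q)); first by near=> t; rewrite pq.
apply: (@smooth_near_meval _ k _ q (fun i t => poly_eval (tnth (in_tuple s) i) (v + nu *: w t))).
move=> i; have sp : tnth (in_tuple s) i \in s by exact: mem_tnth.
move: (tnth _ _) sp => f fs; have fd := degs f fs.
have [finv _ _] := gen'.1 f fs.
pose d := max_degree rho.
apply: (@smooth_near_eq _ _ (fun t => \sum_(e <- index_enum 'I_d.+1) (ray f v (w t))`_e * nu ^+ e)).
  near=> t; rewrite -horner_ray (@horner_coef_wide _ d.+1)//.
  exact: leq_trans (size_ray _ _ _) _.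
apply: smooth_near_sum => e; apply: smooth_near_M; last exact: smooth_near_cst.
apply: (@smooth_near_divX _ k e (fun t => poly_eval (ray_coef f v (u t0) e) (u t))).
- apply: (@smooth_near_le _ k d); first by rewrite -ltnS.
  apply: (smooth_near_stab_invariant orth) => //; last exact: stab_invariant_ray_coef.
  by move=> r rinv; exact: (smooth_near_invariant _ gen rinv uc cK).
- near=> t; rewrite (_ : (fun _ => _) = poly_eval (ray_coef f v 0 e) \o w).
    exact: (continuous_comp (cwv t) (@poly_eval_continuous _ _ _ _)).
  by apply/funext => x; rewrite /= ray_coefE subr0.
- near=> t; rewrite ray_coefE uw addrAC subrr add0r; exact: coef_ray_scale.
Unshelve. all: by end_near. Qed.

Lemma coord_le_enorm (x : 'cV[R]_m) i : `|x i 0| <= enorm x.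
Proof.
rewrite /enorm -sqnormE -sqrtr_sqr; apply: ler_wsqrtr.
by rewrite /sqnorm (bigD1 i)//= lerDl; apply: sumr_ge0 => j _; exact: sqr_ge0.
Qed.

(** A point moved by g stays moved after a small displacement; this lets the
    scale nu be chosen so that stabilisers do not grow. *)
Lemma near_stabilizer v x : \forall nu \near (0 : R), forall g, g \in G ->
  rho g *m (v + nu *: x) = v + nu *: x -> rho g *m v = v.
Proof.
refine (@filter_forall _ _ (fun g (nu : R) => g \in G ->
  rho g *m (v + nu *: x) = v + nu *: x -> rho g *m v = v) (nbhs 0) _ _) => g.
have [gv|/eqP gv] := pselect (rho g *m v = v); first by near=> nu.
have [i vi] : exists i, (rho g *m v) i 0 != v i 0.
  apply: contrapT => H; move/eqP: gv; apply; apply/colP => i.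
  by apply: contrapT => /eqP vi; apply: H; exists i.
pose F (nu : R) := ((rho g *m v) i 0 - v i 0) + nu * ((rho g *m x) i 0 - x i 0).
have cF : {for 0, continuous F}.
  apply: (@Cgerm_cont _ 0); apply: CgermD; first exact: Cgerm_cst.
  by apply: CgermM; [exact: Cgerm_id | exact: Cgerm_cst].
have F0 : F 0 != 0 by rewrite /F mul0r addr0 subr_eq0.
apply: filterS (near_neq0 cF F0) => nu Fnu _ /colP/(_ i).
rewrite mulmxDr -scalemxAr mxE [in X in _ + X = _]mxE [in RHS]mxE [in X in _ = _ + X]mxE => E.
have /eqP[] := Fnu; rewrite /F mulrBr; lra.
Unshelve. all: by end_near. Qed.

(** Let w be the difference quotient of u at t0 and v a small multiple of u t0.
    The curve v + nu * w, reparametrised by squeeze, has an orbit curve U of class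
    k in the neighbourhood where lifting is possible. Translated by a suitable group
    element, its lift e starts at v + nu * w t0, so near 0 it equals g (v + nu * w)
    with g fixing v + nu * w t0, hence fixing u t0. Therefore
    ct = u t0 + (squeeze - t0) / nu * (e - v) equals g u. In the derivative of ct
    at s, the bounded derivative of e is multiplied by squeeze s - t0, which tends
    to 0: the derivative of ct is continuous at 0. *)
Lemma exists_C1_local_lift n (sigma : n.-tuple (mpoly m R)) k c (u : R -> 'cV[R]_m) t0 :
  homogeneous_generators rho sigma -> property_B sigma k ->
  (forall t, orbit_map sigma (u t) = c t) ->
  of_class (add_smoothness k (max_degree rho)) c ->
  (forall t, derivable u t 1) ->
  exists eps ct, [/\ 0 < eps,
    \forall s \near (0 : R), exists2 g, g \in G & u (squeeze t0 eps s) = rho g *m ct s,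
    \forall s \near (0 : R), derivable ct s 1 &
    forall j, {for 0, continuous (fun s => derive1 ct s j 0)}].
Proof.
move=> gen [W W0 HB] uc cK du.
have [w [uw cw]] := difference_quotient t0 du.
set v0 := u t0 in uw; pose w0 := w t0.
have cwv t : {for t, continuous w} by apply/cvg_colP => i; exact: cw.
have [eta eta0 Heta] : exists2 eta : R, 0 < eta &
    forall x : 'cV[R]_m, `|x| < eta -> W (orbit_map sigma x).
  have co : {for 0, continuous (orbit_map sigma)}.
    apply: (proj2 (@cvg_colP R n _ _ (nbhs_filter (0 : 'cV[R]_m)) (orbit_map sigma) _)).
    move=> i; rewrite mxE.
    rewrite (_ : (fun _ => _) = poly_eval (tnth sigma i)).
      exact: poly_eval_continuous.
    by apply/funext => x; rewrite mxE.
  have /nbhs_ballP[eta /= eta0 H] : nbhs (0 : 'cV[R]_m) [set x | W (orbit_map sigma x)].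
    by apply: (co W); rewrite orbit_map0.
  exists eta => // x xeta; apply: H.
  by rewrite -ball_normE /ball_ /= sub0r normrN.
pose mu := eta / (2 * (`|v0| + 1)).
have nv0 : 0 < `|v0| + 1 by rewrite ltr_wpDl.
have mu0 : 0 < mu by rewrite divr_gt0// mulr_gt0.
pose v := mu *: v0.
have v_small : `|v| < eta / 2.
  rewrite normrZ gtr0_norm// /mu mulrAC ltr_pdivrMr ?mulr_gt0//.
  rewrite (_ : eta / 2 * _ = eta * (`|v0| + 1)); last by field.
  by rewrite ltr_pM2l// ltrDl.
have [d d0 Hd] := near_ball (near_stabilizer v w0).
have nw0 : 0 < `|w0| + 1 by rewrite ltr_wpDl.
pose nu := Num.min (d / 2) (eta / (2 * (`|w0| + 1))).
have nu0 : 0 < nu by rewrite lt_min !divr_gt0// mulr_gt0.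
have nud : nu <= d / 2 by rewrite ge_min lexx.
have nuw : nu * (`|w0| + 1) <= eta / 2.
  have : nu <= eta / (2 * (`|w0| + 1)) by rewrite ge_min lexx orbT.
  move=> /(ler_wpM2r (ltW nw0)) /le_trans; apply.
  by rewrite le_eqVlt; apply/orP; left; apply/eqP; field; rewrite gt_eqF.
pose x t := v + nu *: w t.
have stab_x g : g \in G -> rho g *m x t0 = x t0 -> rho g *m v0 = v0.
  move=> gG gx; have : rho g *m v = v.
    by apply: (Hd nu) => //; rewrite subr0 gtr0_norm//; lra.
  rewrite /v -scalemxAr => /(congr1 (fun y => mu^-1 *: y)).
  by rewrite !scalerA mulVf ?gt_eqF// !scale1r.
have stab_v g : g \in G -> rho g *m v0 = v0 -> rho g *m v = v.
  by move=> gG gv; rewrite /v -scalemxAr gv.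
have [eps eps0 Heps] : exists2 eps : R, 0 < eps & forall t, `|t - t0| < eps ->
    `|w t| < `|w0| + 1 /\
    forall i, smooth_at k (fun t => poly_eval (tnth sigma i) (x t)) t.
  apply: near_ball; apply: filterI.
    by apply: (cvgr_norm_lt (w t0) (cwv t0)); rewrite ltrDl.
  refine (@filter_forall _ _ (fun i t => smooth_at k (fun t => poly_eval (tnth sigma i) (x t)) t)
    (nbhs t0) _ _) => i.
  apply: (smooth_near_quotient nu gen uc cK du uw cw stab_v).
  by have [+ _ _] := gen.1 _ (mem_tnth i sigma).
pose phi := squeeze t0 eps.
have phi0 : phi 0 = t0 by exact: squeeze0.
have phi_eps s : `|phi s - t0| < eps by exact: squeeze_lt.
pose U s := orbit_map sigma (x (phi s)).
have cU : of_class k U.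
  apply/of_class_germ => i s; have [_ /(_ i) si] := Heps _ (phi_eps s).
  apply: (@smooth_eq _ _ ((fun t => poly_eval (tnth sigma i) (x t)) \o phi)).
    by near=> s'; rewrite mxE.
  by apply: smooth_comp => //; exact: smooth_squeeze.
have WU s : (W `&` orbit_space sigma) (U s).
  split; last by exists (x (phi s)).
  apply: Heta; apply: le_lt_trans (ler_normD _ _) _.
  have [ws _] := Heps _ (phi_eps s); rewrite [eta]splitr; apply: ltr_leD => //.
  apply: le_trans nuw; rewrite normrZ gtr0_norm//.
  by apply: ler_wpM2l; exact: ltW.
have [I [cl [oI I0 Icl bcl]]] := HB U cU WU 0.
have nI : \forall s \near (0 : R), I s by exact: (open_nbhs_nbhs (conj oI I0)).
have dcl s : I s -> derivable cl s 1 by move=> /Icl[].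
have orb s : I s -> exists2 g, g \in G & cl s = rho g *m x (phi s).
  move=> Is; apply: (orbit_separation orth gen).
  by have [-> _] := Icl s Is.
have [g0 g0G] := orb 0 I0; rewrite phi0 => cl0.
(* the lift translated so as to start at x t0 *)
pose A := rho g0^-1%g; pose e s := A *m cl s.
have e0 : e 0 = x t0 by rewrite /e cl0 actVK.
have orbe s : I s -> exists2 g, g \in G & e s = rho g *m x (phi s).
  move=> Is; have [g gG cls] := orb s Is; exists (g0^-1 * g)%g.
    by rewrite groupM// groupV.
  by rewrite actM ?groupV// /e cls.
have de s i : I s -> is_derive s (1 : R) (fun s => e s i 0) ((A *m derive1 cl s) i 0).
  by move=> Is; apply: is_derive_mulmx_coord; exact: dcl.
have cphi : {for 0, continuous phi} by exact: squeeze_continuous.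
have cxphi i : {for 0, continuous (fun s => x (phi s) i 0)}.
  apply: (@near_eq_continuous _ (fun s => v i 0 + nu * w (phi s) i 0)).
    by near=> s; rewrite !mxE.
  have cc (a : R) : {for 0, continuous (fun _ : R => a)} by exact: cst_continuous.
  apply: (continuousD (cc _)); apply: (continuousM (cc _)).
  exact: (continuous_comp cphi (cw (phi 0) i)).
have avoid : \forall s \near (0 : R), forall g, g \in G ->
    e s = rho g *m x (phi s) -> rho g *m x t0 = x t0.
  refine (@filter_forall _ _ (fun g (s : R) => g \in G ->
    e s = rho g *m x (phi s) -> rho g *m x t0 = x t0) (nbhs 0) _ _) => g.
  have [gx|/eqP gx] := pselect (rho g *m x t0 = x t0); first by near=> s.
  have [i xi] : exists i, x t0 i 0 != (rho g *m x t0) i 0.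
    apply: contrapT => H; move/eqP: gx; apply; apply/esym/colP => i.
    by apply: contrapT => /eqP xi; apply: H; exists i.
  have cF : {for 0, continuous (fun s => e s i 0 - (rho g *m x (phi s)) i 0)}.
    apply: continuousB; first exact: is_derive_continuous (de 0 i I0).
    exact: continuous_mulmx_coord.
  have F0 : e 0 i 0 - (rho g *m x (phi 0)) i 0 != 0.
    by rewrite e0 phi0 subr_eq0.
  apply: filterS (near_neq0 cF F0) => s Fs _ es; exfalso.
  by move: Fs; rewrite es subrr eqxx.
pose ct s := v0 + ((phi s - t0) / nu) *: (e s - v).
pose dct s i := ((phi s - t0) / nu) * (A *m derive1 cl s) i 0 +
  (e s i 0 - v i 0) * (dsqueeze eps s / nu).
have dctE s i : I s -> is_derive s (1 : R) (fun s => ct s i 0) (dct s i).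
  move=> Is; rewrite (_ : (fun _ => _) =
    (fun s => v0 i 0 + ((phi s - t0) / nu) * (e s i 0 - v i 0))); last first.
    by apply/funext => s'; rewrite !mxE.
  have d1 := is_deriveB_pt (is_derive_squeeze t0 eps s) (is_derive_cst t0 s (1 : R)).
  have d2 := is_deriveM_pt d1 (is_derive_cst nu^-1 s (1 : R)).
  have d3 := is_deriveB_pt (de s i Is) (is_derive_cst (v i 0) s (1 : R)).
  have := is_deriveD_pt (is_derive_cst (v0 i 0) s (1 : R)) (is_deriveM_pt d2 d3).
  by rewrite !subr0 mulr0 !add0r [nu^-1 * _]mulrC.
have dct1 s : I s -> derivable ct s 1.
  by move=> Is; apply/derivable_mxP => i j; rewrite ord1; have [] := dctE s i Is.
exists eps, ct; split => //.
- near=> s; have Is : I s by near: s.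
  have [g gG es] := orbe s Is.
  have gx : rho g *m x t0 = x t0 by move: g gG es; near: s.
  have gv0 := stab_x g gG gx; have gv := stab_v g gG gv0.
  exists g^-1%g; first by rewrite groupV.
  suff -> : ct s = rho g *m u (phi s) by rewrite actVK.
  rewrite /ct es /x uw !mulmxDr gv gv0 -!scalemxAr; congr (_ + _).
  by rewrite [v + _]addrC addrK scalerA divfK// gt_eqF.
- by apply: filterS nI.
move=> i; apply: (@near_eq_continuous _ (fun s => dct s i)).
  apply: filterS nI => s Is; have [_ <-] := dctE s i Is.
  by have [_ <-] := is_derive_coord i (dct1 s Is).
have ce : {for 0, continuous (fun s => e s i 0)}.
  exact: is_derive_continuous (de 0 i I0).
have cds := @dsqueeze_continuous R eps.
have cc (a : R) : {for 0, continuous (fun _ : R => a)} by exact: cst_continuous.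
apply: continuousD; last first.
  exact: (continuousM (continuousB ce (cc _)) (continuousM cds (cc nu^-1))).
have [r r0 Hr] := near_ball nI.
have [M HM] : exists M : R, forall s, s \in `[- (r / 2), r / 2] -> enorm (derive1 cl s) <= M.
  have KI : [set` `[- (r / 2), r / 2]] `<=` I.
    move=> s; rewrite /= in_itv /= => /andP[rs sr]; apply: Hr.
    by rewrite subr0 ltr_norml; lra.
  by have [M HM] := bcl _ (@segment_compact R _ _) KI; exists M => s; exact: HM.
apply: (@lip_cont _ _ _ (eps / nu * (\sum_j `|A i j| * M))).
have r20 : 0 < r / 2 by rewrite divr_gt0.
apply: (ball_near r20) => s; rewrite subr0 => sr.
rewrite phi0 subrr !mul0r subr0 normrM.
have sK : s \in `[- (r / 2), r / 2].
  by rewrite in_itv /=; move: sr; rewrite ltr_norml => /andP[? ?]; rewrite !ltW.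
rewrite mulrAC; apply: ler_pM => //.
  rewrite normrM normfV (gtr0_norm nu0) mulrAC ler_pM2r ?invr_gt0//.
  exact: squeeze_lip.
rewrite mxE; apply: le_trans (ler_norm_sum _ _ _) _; apply: ler_sum => j _.
rewrite normrM; apply: ler_wpM2l => //.
exact: le_trans (coord_le_enorm _ _) (HM s sK).
Unshelve. all: by end_near. Qed.

End LocalLift.

Theorem theorem4p2 (R : realType) (gT : finGroupType) (G : {group gT})
    (m : nat) (rho : mx_representation R G m)
    (n : nat) (sigma : n.-tuple (mpoly m R)) (k : smoothness)
    (c : R -> 'cV[R]_n) (cbar : R -> 'cV[R]_m) :
  orthogonal_repr rho ->
  homogeneous_generators rho sigma ->
  property_B sigma k ->
  (forall t, orbit_space sigma (c t)) ->
  of_class (add_smoothness k (max_degree rho)) c ->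
  differentiable_lift_on sigma c setT cbar ->
  of_class (Fin 1) cbar.
Proof.
move=> orth gen HB _ cK lift.
have uc t : orbit_map sigma (cbar t) = c t by have [] := lift t I.
have du t : derivable cbar t 1 by have [] := lift t I.
have cdu i t0 : {for t0, continuous (fun t => derive1 cbar t i 0)}.
  have [eps [ct [eps0 orb dct cct]]] := exists_C1_local_lift orth t0 gen HB uc cK du.
  exact: (derive_continuous_of_orbit eps0 du orb dct cct).
apply: (proj2 (class_Cn_S 0 cbar)); split; first exact: du.
apply: (proj2 (class_Cn_germ 0 (derive1 cbar))) => i t0.
by near=> t; exact: cdu.
Unshelve. all: by end_near. Qed.
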